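(* Let $W$ be a finite Coxeter group with standard Coxeter element $c$ and fixed $c$-compatible reflection ordering $\prec$, and let $\mathcal{P}=\mathcal{A}^!$ with generators $x_t$ ($t\in T$). For a face $f=\{t_1\succ\dots\succ t_j\}$ of $\Delta^+$ let $x_f=x_{t_1}\cdots x_{t_j}$. For each $w\in NC$, the set $\{x_f: f\in\Delta^+,\ \operatorname{nc}(f)=w\}$ is a basis of $\mathcal{P}_w=\operatorname{Span}_k\{x_{t_1}\cdots x_{t_j}: t_1\cdots t_j=w\}$ ($j=\ell_T(w)$). In particular $\{x_f: f\in\Delta^+\}$ is a basis of $\mathcal{P}$.
   Context: $T$ is the set of reflections, $\rho(t)$ the positive root of $t$; $\ell_T$ reflection length, $w\le_T z$ iff $\ell_T(w)+\ell_T(w^{-1}z)=\ell_T(z)$; $NC=[e,c]$, $NC_j$ its elements of length $j$. $\mathcal{A}=k[\mathbf{D}(W)]$ where $\mathbf{D}(W)$ has generators $\mathbf{t}$ and relations $\mathbf{t}\mathbf{u}=\mathbf{u}\mathbf{t}^{\mathbf{u}}$ for $tu\le_T c$ ($\mathbf{t}^{\mathbf{u}}\leftrightarrow utu$); $\mathcal{P}=\mathcal{A}^!$ is its quadratic dual with $(x_t)$ dual to $(\mathbf{t})$. A reflection ordering is a total order on $T$ such that for each rank 2 parabolic subgroup, with reflections $u_1,\dots,u_m$ indexed so that $u_{i+1}u_i=u_iu_{i-1}$ (mod $m$) and $u_1,u_m$ simple, they appear in order $u_1,\dots,u_m$ or its reverse; it is $c$-compatible if for each $w\in NC_2$ with $\{t\le_T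 w\}=\{u_1\prec\dots\prec u_m\}$, $w=u_iu_{i-1}$ for all $i$ ($u_0=u_m$). $\Delta^+$ is the simplicial complex whose facets are sets $\{t_1,\dots,t_n\}\subset T$ with $c=t_1\cdots t_n$ and $\langle\rho(t_i),\rho(t_j)\rangle\ge0$ ($i\ne j$). For a face $f$, its elements can be ordered so that their product lies in $NC_{\#f}$; this product is denoted $\operatorname{nc}(f)$ (well defined). *)

(* Defs.v *)
From HB Require Import structures.
From mathcomp Require Import all_boot all_order all_algebra all_fingroup.
From mathcomp Require Import boolp classical_sets reals trigo.
From mathcomp Require Import monalg.

Set Implicit Arguments.
Unset Strict Implicit.
Unset Printing Implicit Defensive.

Import Order.TTheory GRing.Theory Num.Theory.
Local Open Scope ring_scope.

Section Span.
Variables (k : pzRingType) (M : lmodType k).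

Definition lin_span (S : set M) : set M :=
  fun v => exists (N : nat) (a : 'I_N -> k) (y : 'I_N -> M),
    (forall i, S (y i)) /\ v = \sum_i a i *: y i.

Definition is_basis (I : finType) (A : {set I}) (v : I -> M) (U : set M) :
    Prop :=
  (forall a : I -> k, \sum_(i in A) a i *: v i = 0 ->
     forall i, i \in A -> a i = 0) /\
  lin_span (fun y => exists2 i, i \in A & y = v i) = U.

End Span.

Section TwoSidedIdeal.
Variables (A : nzRingType) (G : set A).

Definition ideal_gen : set A :=
  fun v => exists (N : nat) (a g b : 'I_N -> A),
    (forall i, G (g i)) /\ v = \sum_i a i * g i * b i.

Definition ideal_gen_pred : {pred A} := fun v => `[< ideal_gen v >].

Lemma ideal_genP v : reflect (ideal_gen v) (v \in ideal_gen_pred).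
Proof. exact: asboolP. Qed.

Lemma ideal_gen_zmod_closed : zmod_closed ideal_gen_pred.
Proof.
split.
  apply/ideal_genP; exists 0%N, (fun=> 0), (fun=> 0), (fun=> 0).
  by split=> [[]//|]; rewrite big_ord0.
move=> u v /ideal_genP[N [a [g [b [Gg ->]]]]].
move=> /ideal_genP[N' [a' [g' [b' [Gg' ->]]]]].
pose cat (f : 'I_N -> A) (h : 'I_N' -> A) i :=
  match split i with inl j => f j | inr j => h j end.
apply/ideal_genP.
exists (N + N')%N, (cat a (fun j => - a' j)), (cat g g'), (cat b b').
split=> [i|]; first by rewrite /cat; case: (split i).
rewrite big_split_ord /=; congr (_ + _).
  apply: eq_bigr => i _; rewrite /cat.
  by have -> : split (lshift N' i) = inl i by exact: (unsplitK (inl i)).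
rewrite -[LHS]sumrN; apply: eq_bigr => i _; rewrite /cat.
have -> : split (rshift N i) = inr i by exact: (unsplitK (inr i)).
by rewrite !mulNr.
Qed.

HB.instance Definition _ :=
  GRing.isZmodClosed.Build A ideal_gen_pred ideal_gen_zmod_closed.

Lemma ideal_genMl u v : v \in ideal_gen_pred -> u * v \in ideal_gen_pred.
Proof.
move=> /ideal_genP[N [a [g [b [Gg ->]]]]]; apply/ideal_genP.
exists N, (fun i => u * a i), g, b; split=> //.
by rewrite mulr_sumr; apply: eq_bigr => i _; rewrite !mulrA.
Qed.

Lemma ideal_genMr u v : v \in ideal_gen_pred -> v * u \in ideal_gen_pred.
Proof.
move=> /ideal_genP[N [a [g [b [Gg ->]]]]]; apply/ideal_genP.
exists N, a, g, (fun i => b i * u); split=> //.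
by rewrite mulr_suml; apply: eq_bigr => i _; rewrite !mulrA.
Qed.

End TwoSidedIdeal.

(* Quotient of an algebra by the two-sided ideal generated by G; the ideal has
   to be proper, since algType only covers nontrivial algebras. *)
Section AlgebraQuotient.
Local Open Scope quotient_scope.
Local Notation qrepr := generic_quotient.repr.
Variables (k : comNzRingType) (A : algType k) (G : set A).
Hypothesis properG : 1 \notin ideal_gen_pred G.

Definition alg_quot of 1 \notin ideal_gen_pred G :=
  {ideal_quot (ideal_gen_pred G)}.
Local Notation Q := (alg_quot properG).

HB.instance Definition _ := ZmodQuotient.on Q.

Definition alg_quot_pi (u : A) : Q := \pi_Q u.

Lemma alg_quot_eqP u v :
  reflect (alg_quot_pi u = alg_quot_pi v) (u - v \in ideal_gen_pred G).
Proof. by rewrite Quotient.idealrBE; exact: eqP. Qed.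

Definition alg_quot_one : Q := alg_quot_pi 1.
Definition alg_quot_mul (x y : Q) : Q := alg_quot_pi (qrepr x * qrepr y).
Definition alg_quot_scale (a : k) (x : Q) : Q := alg_quot_pi (a *: qrepr x).

Let piK (x : Q) : alg_quot_pi (qrepr x) = x.
Proof. exact: reprK. Qed.

Let piD u v : alg_quot_pi (u + v) = alg_quot_pi u + alg_quot_pi v.
Proof. by rewrite /alg_quot_pi piE. Qed.

Let reprB u : qrepr (alg_quot_pi u) - u \in ideal_gen_pred G.
Proof. by apply/alg_quot_eqP; rewrite piK. Qed.

Let piM u v :
  alg_quot_mul (alg_quot_pi u) (alg_quot_pi v) = alg_quot_pi (u * v).
Proof.
apply/alg_quot_eqP; set u' := qrepr _; set v' := qrepr _.
have -> : u' * v' - u * v = (u' - u) * v' + u * (v' - v).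
  by rewrite mulrBl mulrBr addrA subrK.
by apply: rpredD; [apply: ideal_genMr | apply: ideal_genMl]; exact: reprB.
Qed.

Let piZ a u : alg_quot_scale a (alg_quot_pi u) = alg_quot_pi (a *: u).
Proof.
apply/alg_quot_eqP; rewrite -scalerBr -[_ - _]mul1r scalerAl.
by apply: ideal_genMl; exact: reprB.
Qed.

Fact alg_quot_mulA : associative alg_quot_mul.
Proof.
by move=> x y z; rewrite -[x]piK -[y]piK -[z]piK !piM mulrA.
Qed.
Fact alg_quot_mul1 : left_id alg_quot_one alg_quot_mul.
Proof. by move=> x; rewrite -[x]piK piM mul1r. Qed.
Fact alg_quot_mulr1 : right_id alg_quot_one alg_quot_mul.
Proof. by move=> x; rewrite -[x]piK piM mulr1. Qed.
Fact alg_quot_mulDl : left_distributive alg_quot_mul +%R.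
Proof.
by move=> x y z; rewrite -[x]piK -[y]piK -[z]piK -piD !piM mulrDl piD.
Qed.
Fact alg_quot_mulDr : right_distributive alg_quot_mul +%R.
Proof.
by move=> x y z; rewrite -[x]piK -[y]piK -[z]piK -piD !piM mulrDr piD.
Qed.
Fact alg_quot_one_neq0 : alg_quot_one != 0.
Proof.
apply/eqP => e; move/negP: properG; apply.
have /alg_quot_eqP : alg_quot_one = alg_quot_pi 0.
  by rewrite e /alg_quot_pi piE.
by rewrite subr0.
Qed.

HB.instance Definition _ := GRing.Zmodule_isNzRing.Build Q
  alg_quot_mulA alg_quot_mul1 alg_quot_mulr1 alg_quot_mulDl alg_quot_mulDr
  alg_quot_one_neq0.

Fact alg_quot_scaleA a b x :
  alg_quot_scale a (alg_quot_scale b x) = alg_quot_scale (a * b) x.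
Proof. by rewrite -[x]piK !piZ scalerA. Qed.
Fact alg_quot_scale1 : left_id 1 alg_quot_scale.
Proof. by move=> x; rewrite -[x]piK piZ scale1r. Qed.
Fact alg_quot_scaleDr : right_distributive alg_quot_scale +%R.
Proof.
by move=> a x y; rewrite -[x]piK -[y]piK -piD !piZ scalerDr piD.
Qed.
Fact alg_quot_scaleDl x : {morph alg_quot_scale^~ x : a b / a + b}.
Proof. by move=> a b; rewrite -[x]piK !piZ scalerDl piD. Qed.

HB.instance Definition _ := GRing.Zmodule_isLmodule.Build k Q
  alg_quot_scaleA alg_quot_scale1 alg_quot_scaleDr alg_quot_scaleDl.

Fact alg_quot_scaleAl (a : k) (x y : Q) : a *: (x * y) = (a *: x) * y.
Proof.
rewrite -[x]piK -[y]piK.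
by change (alg_quot_scale a (alg_quot_mul (alg_quot_pi (qrepr x)) (alg_quot_pi (qrepr y))) = alg_quot_mul (alg_quot_scale a (alg_quot_pi (qrepr x))) (alg_quot_pi (qrepr y)));
  rewrite piM !piZ piM scalerAl.
Qed.
HB.instance Definition _ :=
  GRing.Lmodule_isLalgebra.Build k Q alg_quot_scaleAl.

Fact alg_quot_scaleAr (a : k) (x y : Q) : a *: (x * y) = x * (a *: y).
Proof.
rewrite -[x]piK -[y]piK.
by change (alg_quot_scale a (alg_quot_mul (alg_quot_pi (qrepr x)) (alg_quot_pi (qrepr y))) = alg_quot_mul (alg_quot_pi (qrepr x)) (alg_quot_scale a (alg_quot_pi (qrepr y))));
  rewrite piM !piZ piM scalerAr.
Qed.
HB.instance Definition _ :=
  GRing.Lalgebra_isAlgebra.Build k Q alg_quot_scaleAr.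

Fact alg_quot_pi_linear : linear alg_quot_pi.
Proof. by move=> a u v; rewrite piD -piZ. Qed.
Fact alg_quot_pi_monoid : monoid_morphism alg_quot_pi.
Proof. by split=> // u v; rewrite -piM. Qed.

HB.instance Definition _ :=
  GRing.isLinear.Build k A Q _ alg_quot_pi alg_quot_pi_linear.
HB.instance Definition _ :=
  GRing.isMonoidMorphism.Build A Q alg_quot_pi alg_quot_pi_monoid.

End AlgebraQuotient.

Section QuadraticAlgebra.
Variables (k : fieldType) (X : finType).

Definition free_alg := {malg k[{fmonom X}]}.

HB.instance Definition _ := GRing.Lalgebra.on free_alg.

Fact free_alg_scalerAr (a : k) (u v : free_alg) :
  a *: (u * v) = u * (a *: v).
Proof.
rewrite -!mul_malgC !mulrA; congr (_ * v).
rewrite !malgM_def fgmulUg fgmulgU; apply: eq_bigr => m _.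
by rewrite mulrC mul1m mulm1.
Qed.

HB.instance Definition _ :=
  GRing.Lalgebra_isAlgebra.Build k free_alg free_alg_scalerAr.

Definition free_gen (x : X) : free_alg := << fmu x >>.

(* For V with basis X, an element of V (x) V is given by its coordinates:
   r (x, y) is the coefficient of x (x) y. *)
Definition tensor2 := {ffun X * X -> k}.

Definition tensor2_free (r : tensor2) : free_alg :=
  \sum_(p : X * X) r p *: (free_gen p.1 * free_gen p.2).

Definition quad_rels (Rel : set tensor2) : set free_alg :=
  fun v => exists2 r, Rel r & v = tensor2_free r.

Lemma quad_rels_proper (Rel : set tensor2) :
  1 \notin ideal_gen_pred (quad_rels Rel).
Proof.
apply/ideal_genP => -[N [a [g [b [Gg]]]]].
move/(congr1 (mcoeff (mone : {fmonom X}))); rewrite rmorph1 raddf_sum /= big1 => [/eqP|i _].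
  by rewrite oner_eq0.
have [r _ ->] := Gg i.
rewrite !rmorphM /= /tensor2_free raddf_sum /= big1 ?mulr0 ?mul0r // => p _.
rewrite mcoeffZ rmorphM /= /free_gen mcoeffU1.
by rewrite fm1_eq1 mul0r mulr0.
Qed.

Definition quad_alg (Rel : set tensor2) := alg_quot (quad_rels_proper Rel).

HB.instance Definition _ (Rel : set tensor2) :=
  GRing.Algebra.on (quad_alg Rel).

Definition quad_gen (Rel : set tensor2) (x : X) : quad_alg Rel :=
  alg_quot_pi (quad_rels_proper Rel) (free_gen x).

(* Annihilator of Rel in V* (x) V*, in coordinates on the basis dual to X. *)
Definition rel_orth (Rel : set tensor2) : set tensor2 :=
  fun q => forall r, Rel r -> \sum_(p : X * X) q p * r p = 0.

Definition quad_dual (Rel : set tensor2) := quad_alg (rel_orth Rel).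

HB.instance Definition _ (Rel : set tensor2) :=
  GRing.Algebra.on (quad_dual Rel).

Definition quad_dual_gen (Rel : set tensor2) (x : X) : quad_dual Rel :=
  quad_gen (rel_orth Rel) x.

End QuadraticAlgebra.

Section CoxeterGroup.
Variables (gT : finGroupType) (n : nat) (s : 'I_n -> gT).

(* Since gT is finite, all the orders m_ij = #[s i * s j] are finite. The last
   clause is the universal property of the presentation
   < s_i | (s_i s_j)^m_ij = 1 >. *)
Definition coxeter_system : Prop :=
  [/\ injective s,
      forall i, #[s i]%g = 2%N,
      <<[set s i | i : 'I_n]>>%g = [set: gT] &
      forall (H : groupType) (f : 'I_n -> H),
        (forall i j, ((f i * f j) ^+ #[s i * s j])%g = 1%g) ->
        exists2 phi : gT -> H,
          forall x y, phi (x * y)%g = (phi x * phi y)%g &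
          forall i, phi (s i) = f i].

Definition coxeter_element (c : gT) : Prop :=
  exists p : 'S_n, c = (\prod_(i < n) s (p i))%g.

Definition reflections : {set gT} := [set (s i ^ g)%g | i : 'I_n, g : gT].

Definition refl : finType := {t : gT | t \in reflections}.

(* The least m with w in T ^+ m (product of subsets). The bound #|gT| is
   harmless when T generates: the prefixes of a shortest word are distinct. *)
Definition refl_length (w : gT) : nat :=
  find (fun m => w \in (reflections ^+ m)%g) (iota 0 #|gT|).

Definition abs_le (w z : gT) : bool :=
  (refl_length w + refl_length (w^-1 * z)%g == refl_length z)%N.

Definition NC (c : gT) : {set gT} := [set w | abs_le w c].

Definition NC_rank (c : gT) (j : nat) : {set gT} :=
  [set w in NC c | refl_length w == j].

Section Roots.
Variable R : realType.

(* Geometric representation on R^n, with basis the simple roots. *)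
Definition root_gram : 'M[R]_n :=
  \matrix_(i, j) - cos (pi / (#[s i * s j]%g)%:R).

Definition root_form (v w : 'rV[R]_n) : R := (v *m root_gram *m w^T) 0 0.

Definition simple_root (i : 'I_n) : 'rV[R]_n := delta_mx 0 i.

Definition simple_act (i : 'I_n) (v : 'rV[R]_n) : 'rV[R]_n :=
  v - (2 * root_form v (simple_root i)) *: simple_root i.

(* With u = s_{i_1} ... s_{i_l}: the reflection u s_i u^-1 has root u(alpha_i). *)
Definition is_pos_root_of (t : gT) (v : 'rV[R]_n) : Prop :=
  exists (i : 'I_n) (word : seq 'I_n),
    let u := (\prod_(j <- word) s j)%g in
    [/\ t = (u * s i * u^-1)%g,
        v = foldr simple_act (simple_root i) word &
        forall j, 0 <= v 0 j].

(* rho(t) *)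
Definition pos_root (t : gT) : 'rV[R]_n := xget 0 (is_pos_root_of t).

Definition rank2_parabolic (P : {set gT}) : Prop :=
  exists i j g, i != j /\ P = (<<[set s i; s j]>> :^ g)%g.

(* t is a simple reflection of the parabolic subgroup P: its root is
   indecomposable among the positive roots of P. *)
Definition parabolic_simple (P : {set gT}) (t : gT) : Prop :=
  t \in reflections :&: P /\
  ~ exists a : gT -> R, (forall u, 0 <= a u) /\
      pos_root t = \sum_(u in (reflections :&: P) :\ t) a u *: pos_root u.

(* u_{i+1}, with indices mod the size of u *)
Definition cyc_nth (u : seq refl) (i : nat) : gT :=
  nth 1%g [seq val t | t <- u] (i %% size u).

Definition reflection_ordering (prec : rel refl) : Prop :=
  [/\ irreflexive prec, transitive prec,
      forall t u, t != u -> prec t u || prec u t &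
      forall (P : {set gT}) (u : seq refl), rank2_parabolic P ->
        uniq u -> (forall t, (t \in u) = (val t \in P)) ->
        (forall i, (cyc_nth u i.+2 * cyc_nth u i.+1)%g =
                   (cyc_nth u i.+1 * cyc_nth u i)%g) ->
        parabolic_simple P (cyc_nth u 0) ->
        parabolic_simple P (cyc_nth u (size u).-1) ->
        sorted prec u \/ sorted prec (rev u)].

Definition c_compatible (c : gT) (prec : rel refl) : Prop :=
  forall (w : gT) (u : seq refl), w \in NC_rank c 2 ->
    sorted prec u -> (forall t, (t \in u) = abs_le (val t) w) ->
    forall i, w = (cyc_nth u i.+1 * cyc_nth u i)%g.

Definition is_pos_facet (c : gT) (F : {set refl}) : bool :=
  [exists r : n.-tuple refl,
    [&& F == [set t in r],
        c == (\prod_(t <- r) val t)%g &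
        [forall i, forall j, (i != j) ==>
          (0 <= root_form (pos_root (val (tnth r i)))
                          (pos_root (val (tnth r j))))]]].

(* Delta^+, as its set of faces (including the empty one) *)
Definition pos_cluster_complex (c : gT) : {set {set refl}} :=
  [set f : {set refl} | [exists F, is_pos_facet c F && (f \subset F)]].

End Roots.

Definition nc (c : gT) (f : {set refl}) : gT :=
  odflt 1%g [pick w in NC_rank c #|f| |
    [exists r : #|f|.-tuple refl,
      (f == [set t in r]) && (w == (\prod_(t <- r) val t)%g)]].

Section DualBraidMonoid.
Variables (k : fieldType) (c : gT).

Definition pure_tensor (t u : refl) : tensor2 k refl :=
  [ffun p => (p == (t, u))%:R].

(* A = k[D(W)] is presented by the generators t and the quadratic relations
   t (x) u - u (x) (u t u), for tu <=_T c. *)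
Definition dual_braid_rels : set (tensor2 k refl) :=
  fun r => exists t u t' : refl,
    [/\ abs_le (val t * val u)%g c,
        val t' = (val u * val t * val u)%g &
        r = pure_tensor t u - pure_tensor u t'].

Definition dual_braid_alg := quad_alg dual_braid_rels.

Definition dual_braid_dual := quad_dual dual_braid_rels.

HB.instance Definition _ := GRing.Algebra.on dual_braid_dual.

Local Notation P := dual_braid_dual.

Definition xgen (t : refl) : P := quad_dual_gen dual_braid_rels t.

Definition xword (r : seq refl) : P := \prod_(t <- r) xgen t.

Definition P_part (w : gT) : set P :=
  lin_span (fun y => exists2 r : (refl_length w).-tuple refl,
    (\prod_(t <- r) val t)%g = w & y = xword r).

Definition xface (prec : rel refl) (f : {set refl}) : P :=
  xword (sort (fun t u => (t == u) || prec u t) (enum f)).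

End DualBraidMonoid.
End CoxeterGroup.

Arguments P_part [gT n] s k c w _.

(* Main.v *)
Require Import Defs.
From HB Require Import structures.
From mathcomp Require Import all_boot all_order all_algebra all_fingroup.
From mathcomp Require Import boolp classical_sets reals.
From mathcomp Require Import cyclic trigo finmap monalg.
From mathcomp Require Import zify ring lra.

Set Implicit Arguments.
Unset Strict Implicit.
Unset Printing Implicit Defensive.

Import Order.TTheory GRing.Theory Num.Theory.
Local Open Scope ring_scope.

(** The ordering being c-compatible, an element of rank two of NC has exactly one
    increasing factorization, made of the two simple reflections of its
    parabolic subgroup, all other factorizations being decreasing pairs of
    adjacent reflections, whose roots form an acute angle. Let chi be the Wall
    form of c, [chi u v = <(c - 1)^-1 u, v>]. A word t_1 ... t_j is a reduced
    word of an element of NC iff chi vanishes on each pair of roots of t_i, t_k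
    with i < k; so faces of the positive cluster complex are the decreasing such
    words: a lexicographically maximal word for c containing a given decreasing
    word is itself decreasing, whence purity.

    In the algebra, words which are not reduced words of elements of NC vanish,
    by rewriting with the relation of rank two; rewriting the increasing pairs
    then shows that decreasing words span. For independence, each decreasing
    word f defines a linear form, the signed sum over the maximal chains of the
    Boolean lattice of the products of the subwords of f: it kills the relations,
    takes the value 1 at f, and its other chains are lexicographically smaller
    than f. *)

(** The group is known only through its presentation and its finiteness. Roots enter by the
    geometric representation, whose form is proved positive definite by comparison with an averaged
    inner product; reflection length then becomes the codimension of the fixed space, and [c] turns
    out to fix no nonzero vector, so that chi is defined. The gain from chi is that a condition on a
    whole word becomes bilinear in the roots of pairs of letters: it passes to subwords, and linear
    dependence inside a plane of roots propagates its failure.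

    In coordinates, the annihilator of the relations consists of the functions on pairs which are
    constant along the Hurwitz moves [(t, u) -> (u, u t u)] below [c]. Rewriting yields only
    spanning; independence is obtained from linear forms on the free algebra. The form of a word
    [t f] comes from that of [f] by inserting [t], suitably conjugated, at every place of a word,
    with alternating signs. Insertions just before and just after a letter cancel by Hurwitz
    invariance, which needs the resulting pair to lie below [c]. *)

Lemma mulr_sum3 (A : nzRingType) (I J : Type) (K : finType) (r : seq I)
    (r' : seq J) (x : I -> A) (y : K -> A) (z : J -> A) :
  (\sum_(i <- r) x i) * (\sum_k y k) * (\sum_(j <- r') z j) =
  \sum_(i <- r) \sum_(j <- r') \sum_k x i * y k * z j.
Proof.
rewrite !mulr_suml; apply: eq_bigr => i _; rewrite mulr_sumr.
by apply: eq_bigr => j _; rewrite mulr_sumr mulr_suml.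
Qed.

Section LinearSpan.
Variables (k : pzRingType) (M : lmodType k).
Implicit Types (S : set M) (u v : M).

Lemma lin_span_gen S v : S v -> lin_span S v.
Proof.
move=> Sv; exists 1%N, (fun=> 1), (fun=> v); split=> //.
by rewrite big_ord1 scale1r.
Qed.

Lemma lin_span0 S : lin_span S 0.
Proof.
exists 0%N, (fun=> 0), (fun=> 0); split=> [[]//|].
by rewrite big_ord0.
Qed.

Lemma lin_spanZ S a v : lin_span S v -> lin_span S (a *: v).
Proof.
case=> N [b [y [Sy ->]]]; exists N, (fun i => a * b i), y; split=> //.
by rewrite scaler_sumr; apply: eq_bigr => i _; rewrite scalerA.
Qed.

Lemma lin_spanN S v : lin_span S v -> lin_span S (- v).
Proof. by rewrite -scaleN1r; exact: lin_spanZ. Qed.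

Lemma lin_spanD S u v : lin_span S u -> lin_span S v -> lin_span S (u + v).
Proof.
move=> [N [a [y [Sy ->]]]] [N' [a' [y' [Sy' ->]]]].
exists (N + N')%N, (fun i => match split i with inl j => a j | inr j =>
  a' j end),
  (fun i => match split i with inl j => y j | inr j => y' j end); split.
  by move=> i; case: (split i).
rewrite big_split_ord /=; congr (_ + _); apply: eq_bigr => i _.
  by have -> : split (lshift N' i) = inl i by exact: (unsplitK (inl i)).
by have -> : split (rshift N i) = inr i by exact: (unsplitK (inr i)).
Qed.

Lemma lin_span_sum S (I : Type) (r : seq I) (P : pred I) (F : I -> M) :
  (forall i, P i -> lin_span S (F i)) -> lin_span S (\sum_(i <- r | P i) F i).
Proof.
move=> h; elim/big_ind: _ => [|u v|i /h//]; first exact: lin_span0.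
exact: lin_spanD.
Qed.

Lemma lin_span_sub S S' v : (forall u, S u -> lin_span S' u) ->
  lin_span S v -> lin_span S' v.
Proof.
move=> h [N [a [y [Sy ->]]]]; apply: lin_span_sum => i _.
by apply: lin_spanZ; apply: h.
Qed.

End LinearSpan.

(** * Reflections of the form [root_form] *)

Section Form.
Variables (R : realType) (gT : finGroupType) (n : nat) (s : 'I_n -> gT).
Local Notation V := 'rV[R]_n.
Local Notation B := (@root_form gT n s R).
Local Notation alpha := (@simple_root n R).

Lemma root_formDl u v w : B (u + v) w = B u w + B v w.
Proof. by rewrite /root_form !mulmxDl mxE. Qed.
Lemma root_formDr u v w : B w (u + v) = B w u + B w v.
Proof. by rewrite /root_form linearD mulmxDr mxE. Qed.
Lemma root_formZl a u w : B (a *: u) w = a * B u w.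
Proof. by rewrite /root_form -!scalemxAl mxE. Qed.
Lemma root_formZr a u w : B w (a *: u) = a * B w u.
Proof. by rewrite /root_form linearZ -scalemxAr mxE. Qed.
Lemma root_formNl u w : B (- u) w = - B u w.
Proof. by rewrite -scaleN1r root_formZl mulN1r. Qed.
Lemma root_formNr u w : B w (- u) = - B w u.
Proof. by rewrite -scaleN1r root_formZr mulN1r. Qed.
Lemma root_form0l w : B 0 w = 0.
Proof. by rewrite -(scale0r (0 : V)) root_formZl mul0r. Qed.
Lemma root_form0r w : B w 0 = 0.
Proof. by rewrite -(scale0r (0 : V)) root_formZr mul0r. Qed.
Lemma root_form_suml (I : Type) (r : seq I) (P : pred I) (F : I -> V) w :
  B (\sum_(i <- r | P i) F i) w = \sum_(i <- r | P i) B (F i) w.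
Proof.
exact: (big_morph (B^~ w) (fun u v => root_formDl u v w) (root_form0l w)).
Qed.
Lemma root_form_sumr (I : Type) (r : seq I) (P : pred I) (F : I -> V) w :
  B w (\sum_(i <- r | P i) F i) = \sum_(i <- r | P i) B w (F i).
Proof.
exact: (big_morph (B w) (fun u v => root_formDr u v w) (root_form0r w)).
Qed.

Definition root_formE := (root_formDl, root_formDr, root_formNl, root_formNr,
  root_formZl, root_formZr).

Lemma simple_root_formE i j :
  B (alpha i) (alpha j) = - cos (pi / (#[s i * s j]%g)%:R).
Proof.
by rewrite /root_form /simple_root -rowE trmx_delta -colE !mxE.
Qed.

Lemma row_sum_simple (x : V) : x = \sum_i x 0 i *: alpha i.
Proof. exact: row_sum_delta. Qed.

Lemma coordD (u v : V) j : (u + v) 0 j = u 0 j + v 0 j. Proof. exact: mxE. Qed.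
Lemma coordN (u : V) j : (- u) 0 j = - u 0 j. Proof. exact: mxE. Qed.
Lemma coordZ a (u : V) j : (a *: u) 0 j = a * u 0 j. Proof. exact: mxE. Qed.
Definition coordE := (coordD, coordN, coordZ).

Definition rfl (a x : V) : V := x - (2 * B x a) *: a.

Lemma rflD a x y : rfl a (x + y) = rfl a x + rfl a y.
Proof. by rewrite /rfl root_formDl mulrDr scalerDl opprD addrACA. Qed.
Lemma rflZ a k x : rfl a (k *: x) = k *: rfl a x.
Proof. by rewrite /rfl root_formZl scalerBr scalerA mulrCA. Qed.
Lemma rflNa a x : rfl (- a) x = rfl a x.
Proof. by rewrite /rfl root_formNr mulrN scaleNr scalerN opprK. Qed.

Hypothesis order_s : forall i, #[s i]%g = 2%N.

Lemma simpleK i : (s i * s i = 1)%g.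
Proof. by rewrite -[RHS](expg_order (s i)) order_s. Qed.

Lemma simpleV i : ((s i)^-1 = s i)%g.
Proof. by apply: (mulgI (s i)); rewrite mulgV simpleK. Qed.

Lemma order_simpleC i j : #[s i * s j]%g = #[s j * s i]%g.
Proof. by rewrite -orderV invMg !simpleV. Qed.

Lemma root_formC u v : B u v = B v u.
Proof.
have -> : B u v = ((u *m root_gram s R *m v^T)^T) 0 0 by rewrite mxE.
rewrite !trmx_mul trmxK mulmxA /root_form; congr ((_ *m _ *m _) 0 0);
  apply/matrixP => i j.
by rewrite !mxE order_simpleC.
Qed.

Lemma simple_root_norm i : B (alpha i) (alpha i) = 1.
Proof. by rewrite simple_root_formE simpleK order1 divr1 cospi opprK. Qed.

Section UnitReflection.
Variable a : V.
Hypothesis a1 : B a a = 1.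

Lemma rflK x : rfl a (rfl a x) = x.
Proof.
have e : B (rfl a x) a = - B x a by rewrite /rfl !root_formE a1; ring.
by rewrite {1}/rfl e; apply/rowP => j; rewrite !mxE; ring.
Qed.

Lemma rfl_id : rfl a a = - a.
Proof. by rewrite /rfl a1; apply/rowP => j; rewrite !mxE; ring. Qed.

Lemma rfl_isom x y : B (rfl a x) (rfl a y) = B x y.
Proof. by rewrite /rfl !root_formE a1 (root_formC a y); ring. Qed.

Lemma rfl_eq x : B x a = 0 -> rfl a x = x.
Proof. by rewrite /rfl => ->; rewrite mulr0 scale0r subr0. Qed.

End UnitReflection.

Section Dihedral.
Variables (a b : V) (th : R).
Hypotheses (a1 : B a a = 1) (b1 : B b b = 1) (ab : B a b = - cos th).

Lemma rfl_combl x y : rfl a (x *: a + y *: b) =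
  (2 * cos th * y - x) *: a + y *: b.
Proof.
rewrite /rfl !root_formE a1 (root_formC b a) ab addrAC -scalerBl.
by congr (_ *: _ + _); ring.
Qed.

Lemma rfl_combr x y : rfl b (x *: a + y *: b) =
  x *: a + (2 * cos th * x - y) *: b.
Proof.
rewrite /rfl !root_formE b1 ab -addrA -scalerBl.
by congr (_ + _ *: _); ring.
Qed.

Lemma sin_step t : sin (t + th + th) = 2 * cos th * sin (t + th) - sin t.
Proof.
have {3}-> : t = t + th - th by rewrite addrK.
by rewrite sinB sinD; ring.
Qed.

(* [dihedral_vec t] is the vector of the plane at angle [t] from [a], up to the
   factor [sin th]. *)
Definition dihedral_vec t : V := sin (t + th) *: a + sin t *: b.

Lemma rfl_dihedral_vecr t : rfl b (dihedral_vec t) =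
  sin (t + th) *: a + sin (t + th + th) *: b.
Proof. by rewrite rfl_combr sin_step. Qed.

Lemma rfl_dihedral_vec t : rfl a (rfl b (dihedral_vec t)) =
  dihedral_vec (t + th + th).
Proof. by rewrite rfl_dihedral_vecr rfl_combl -sin_step. Qed.

Lemma iter_dihedral_vec k t :
  iter k (rfl a \o rfl b) (dihedral_vec t) =
    dihedral_vec (t + (k%:R * th) *+ 2).
Proof.
elim: k => [|k IHk]; first by rewrite mul0r mul0rn addr0.
rewrite iterS IHk /= rfl_dihedral_vec; congr dihedral_vec.
by rewrite -[k.+1]addn1 natrD mulr2n; ring.
Qed.

Hypothesis th0 : sin th != 0.

Lemma iter_scalable (f : V -> V) k : (forall a x, f (a *: x) = a *: f x) ->
  forall a x, iter k f (a *: x) = a *: iter k f x.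
Proof. by move=> fZ c x; elim: k => //= k ->. Qed.

Lemma iter_isom (f : V -> V) k : (forall x y, B (f x) (f y) = B x y) ->
  forall x y, B (iter k f x) (iter k f y) = B x y.
Proof. by move=> fB x y; elim: k => //= k <-; rewrite fB. Qed.

(** The form is not yet known to be definite. The iterate fixes [a] and [b], the angle having grown
    by a full turn, and it moves any [x] by a vector of their plane. Being an isometry, it moves [x]
    orthogonally to this plane, whose Gram determinant [sin th ^+ 2] is nonzero; so [x] does not
    move. *)
Lemma iter_dihedral (m : nat) : m%:R * th = pi ->
  forall x, iter m (rfl a \o rfl b) x = x.
Proof.
move=> mth; pose f := rfl a \o rfl b.
have fD x y : f (x + y) = f x + f y by rewrite /f /= !rflD.
have fZ k x : f (k *: x) = k *: f x by rewrite /f /= !rflZ.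
have iZ k := iter_scalable k fZ.
have iB k : forall x y, B (iter k f x) (iter k f y) = B x y.
  by apply: iter_isom => x y; rewrite /f /= !rfl_isom.
have per t : iter m f (dihedral_vec t) = dihedral_vec t.
  rewrite iter_dihedral_vec mth /dihedral_vec.
  by rewrite addrAC !sinD2pi.
have fa : iter m f a = a.
  have := per 0; rewrite /dihedral_vec add0r sin0 scale0r addr0 iZ.
  by move=> /(scalerI th0).
have fb : iter m f b = b.
  (* [dihedral_vec (- th)] is a multiple of [b], as [dihedral_vec 0] is of [a]. *)
  have := per (- th); rewrite /dihedral_vec addNr sin0 scale0r add0r sinN iZ.
  by apply: scalerI; rewrite oppr_eq0.
move=> x; have [p [q IH]] : exists p q, iter m f x = x + (p *: a + q *: b).
  elim: (m) => [|k [p [q IH]]]; first by exists 0, 0; rewrite !scale0r !addr0.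
  rewrite iterS IH fD /f /= [rfl b x]/rfl rfl_combr rfl_combl rflD -scaleNr
    rflZ.
  exists (- 2 * B x a - 4 * B x b * cos th +
    (2 * cos th * (2 * cos th * p - q) - p)).
  exists (- 2 * B x b + (2 * cos th * p - q)).
  by apply/rowP => j; rewrite /rfl (root_formC b a) ab !mxE; ring.
have orth y : iter m f y = y -> B (p *: a + q *: b) y = 0.
  by move=> fy; have := iB m x y; rewrite IH fy root_formDl =>
    /(canRL (addKr _)) ->; rewrite addNr.
have := orth a fa; have := orth b fb.
rewrite !root_formE a1 b1 (root_formC b a) ab !mulr1 => e1 e2.
have q0 : q * sin th ^+ 2 = 0.
  rewrite sin2cos2.
  have -> : q * (1 - cos th ^+ 2) = (p * - cos th + q) + cos th * (p +
    q * - cos th) by ring.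
  by rewrite e1 e2 mulr0 addr0.
have {q0} q0 : q = 0.
  by apply/eqP; move/eqP: q0; rewrite mulf_eq0 expf_eq0 (negPf th0) /= orbF.
have p0 : p = 0 by move: e2; rewrite q0 mul0r addr0.
by rewrite IH p0 q0 !scale0r !addr0.
Qed.

End Dihedral.
End Form.

(** * The geometric representation *)

Section UnitMatrixGroup.
Variables (F : fieldType) (n : nat).

(** The universal property of the presentation will be applied to this group, which is not finite in
    general. *)
Definition unit_matrix := {M : 'M[F]_n | M \in unitmx}.

HB.instance Definition _ := Choice.on unit_matrix.

Definition mk_unit_matrix (M : 'M[F]_n) (uM : M \in unitmx) : unit_matrix :=
  exist _ M uM.

Implicit Types M N : unit_matrix.

Fact unit_matrix_mul_proof M N : val M *m val N \in unitmx.
Proof. by rewrite unitmx_mul !(valP M, valP N). Qed.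
Fact unit_matrix_inv_proof M : invmx (val M) \in unitmx.
Proof. by rewrite unitmx_inv (valP M). Qed.

Definition unit_matrix_mul M N : unit_matrix :=
  mk_unit_matrix (unit_matrix_mul_proof M N).
Definition unit_matrix_inv M : unit_matrix :=
  mk_unit_matrix (unit_matrix_inv_proof M).
Definition unit_matrix_one : unit_matrix := mk_unit_matrix (unitmx1 F n).

Fact unit_matrix_mulA : associative unit_matrix_mul.
Proof. by move=> M N L; apply: val_inj; rewrite /= mulmxA. Qed.
Fact unit_matrix_mul1 : left_id unit_matrix_one unit_matrix_mul.
Proof. by move=> M; apply: val_inj; rewrite /= mul1mx. Qed.
Fact unit_matrix_mulr1 : right_id unit_matrix_one unit_matrix_mul.
Proof. by move=> M; apply: val_inj; rewrite /= mulmx1. Qed.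
Fact unit_matrix_mulV : left_inverse unit_matrix_one unit_matrix_inv
  unit_matrix_mul.
Proof. by move=> M; apply: val_inj; rewrite /= mulVmx ?(valP M). Qed.
Fact unit_matrix_mulVr : right_inverse unit_matrix_one unit_matrix_inv
  unit_matrix_mul.
Proof. by move=> M; apply: val_inj; rewrite /= mulmxV ?(valP M). Qed.

HB.instance Definition _ := isGroup.Build unit_matrix unit_matrix_mulA
  unit_matrix_mul1 unit_matrix_mulr1 unit_matrix_mulV unit_matrix_mulVr.

End UnitMatrixGroup.

Section Representation.
Variables (R : realType) (gT : finGroupType) (n : nat) (s : 'I_n -> gT).
Hypothesis hW : coxeter_system s.
Local Notation V := 'rV[R]_n.
Local Notation B := (@root_form gT n s R).
Local Notation alpha := (@simple_root n R).
Local Notation rfl := (@rfl R gT n s).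

Lemma order_simple i : #[s i]%g = 2%N. Proof. by case: hW. Qed.

Lemma simple_inj : injective s. Proof. by case: hW. Qed.

Local Notation sK := (simpleK order_simple).
Local Notation BC := (@root_formC R gT n s order_simple).

Lemma order_simple_gt1 i j : i != j -> (1 < #[s i * s j]%g)%N.
Proof.
move=> ij; rewrite ltn_neqAle order_gt0 andbT eq_sym order_eq1.
apply: contra ij => /eqP e; apply/eqP/simple_inj.
by apply: (mulIg (s j)); rewrite e sK.
Qed.

Definition braid_angle i j : R := pi / (#[s i * s j]%g)%:R.

Lemma braid_angle_pi i j : (#[s i * s j]%g)%:R * braid_angle i j = pi.
Proof. by rewrite mulrC divfK // pnatr_eq0 -lt0n order_gt0. Qed.

Lemma braid_angle_gt0 i j : 0 < braid_angle i j.
Proof. by rewrite divr_gt0 ?pi_gt0 // ltr0n order_gt0. Qed.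

Lemma braid_angle_le i j : i != j -> braid_angle i j <= pi / 2.
Proof.
move=> ij; rewrite ler_pM2l ?pi_gt0 // lef_pV2 ?posrE ?ltr0n ?order_gt0 //.
by rewrite ler_nat order_simple_gt1.
Qed.

Lemma sin_braid_angle_gt0 i j : i != j -> 0 < sin (braid_angle i j).
Proof.
move=> ij; apply: sin_gt0_pi; rewrite braid_angle_gt0 /=.
by apply: (le_lt_trans (braid_angle_le ij)); have := pi_gt0 R; lra.
Qed.

Lemma simple_root_form_angle i j : B (alpha i) (alpha j) =
  - cos (braid_angle i j).
Proof. exact: simple_root_formE. Qed.

Local Notation norm1 := (@simple_root_norm R gT n s order_simple).

Definition simple_mx i : 'M[R]_n :=
  1%:M - 2 *: (root_gram s R *m (alpha i)^T *m alpha i).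

Lemma simple_mxE i x : x *m simple_mx i = rfl (alpha i) x.
Proof.
rewrite /simple_mx mulmxBr mulmx1 /rfl; congr (_ - _).
rewrite -scalemxAr !mulmxA (mx11_scalar (_ *m _ *m _^T)) mul_scalar_mx.
by rewrite scalerA.
Qed.

Lemma simple_mx_unit i : simple_mx i \in unitmx.
Proof.
apply: (@mulmx1_unit _ _ _ (simple_mx i) _).1.
by apply/row_matrixP => j; rewrite !row_mul !rowE !simple_mxE rflK ?norm1 //
  mulmx1.
Qed.

Lemma unit_matrix_expE (F : fieldType) (M : unit_matrix F n) m :
  val (M ^+ m)%g = iter m (mulmx (val M)) 1%:M.
Proof. by elim: m => [|m IH] //=; rewrite expgS /= IH. Qed.

Lemma geometric_representation : exists Phi : gT -> 'M[R]_n,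
  [/\ Phi 1%g = 1%:M, forall g h, Phi (g * h)%g = Phi g *m Phi h &
      forall i, Phi (s i) = simple_mx i].
Proof.
have [_ _ _ univ] := hW.
have [|phi phiM phis] := univ (unit_matrix R n) (fun i =>
  mk_unit_matrix (simple_mx_unit i)).
  move=> i j; apply: val_inj; rewrite unit_matrix_expE /=.
  set m := #[_]%g.
  have it x : forall k, x *m iter k (mulmx (simple_mx i *m simple_mx j)) 1%:M
      = iter k (rfl (alpha j) \o rfl (alpha i)) x.
    move=> k; elim: k x => [|k IH] x; first by rewrite mulmx1.
    by rewrite [RHS]iterSr /= !mulmxA !simple_mxE IH.
  apply/row_matrixP => l; rewrite !rowE it mulmx1.
  case: (eqVneq i j) => [ij|ij].
    have -> : m = 1%N by rewrite /m ij sK order1.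
    by rewrite /= ij rflK ?norm1.
  apply: (@iter_dihedral R gT n s order_simple _ _ (braid_angle j i));
    rewrite ?norm1 //.
  - by rewrite simple_root_form_angle.
  - by rewrite gt_eqF // sin_braid_angle_gt0 // eq_sym.
  - by rewrite /m order_simpleC ?braid_angle_pi //; exact: order_simple.
exists (fun g => val (phi g)); split=> [|g h|i]; rewrite ?phiM ?phis //.
have e : phi 1%g = 1%g by apply: (mulgI (phi 1%g)); rewrite -phiM !mulg1.
by rewrite e.
Qed.

End Representation.

(** * Length and positivity of roots *)

Section Words.
Variables (gT : finGroupType) (n : nat) (s : 'I_n -> gT).
Hypothesis hW : coxeter_system s.

Local Notation sK := (simpleK (order_simple hW)).

Definition sword (w : seq 'I_n) : gT := (\prod_(j <- w) s j)%g.

Lemma swordP g : exists w, g = sword w.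
Proof.
have : g \in <<[set s i | i : 'I_n]>>%g by case: hW => _ _ -> _; rewrite inE.
case/gen_prodgP => m [f fs ->].
have {fs} /fin_all_exists[h hE] : forall i, exists j, f i = s j.
  by move=> i; have /imsetP[j _ ->] := fs i; exists j.
exists [seq h i | i <- index_enum 'I_m]; rewrite /sword big_map.
by apply: eq_bigr => i _.
Qed.

(** Sending every generator to the same transposition respects the presentation. The sign shows that
    [g] and [g * s i] have different lengths and, later, that a product of two reflections is not a
    reflection. *)
Lemma simple_sign : exists sg : gT -> bool,
  (forall g h, sg (g * h)%g = sg g (+) sg h) /\ (forall i, sg (s i)).
Proof.
have [_ _ _ univ] := hW.
have [|phi phiM phis] := univ {perm bool} (fun=> tperm true false).
  by move=> i j; rewrite tperm2 expg1n.
exists (fun g => odd_perm (phi g)); split=> [g h|i].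
  by rewrite phiM odd_permM.
by rewrite phis odd_tperm.
Qed.

Fact len_subproof g : exists m, [exists w : m.-tuple 'I_n, g == sword w].
Proof.
by have [w ->] := swordP g; exists (size w); apply/existsP; exists (in_tuple w).
Qed.

(** Length in the simple reflections, as opposed to [refl_length]. *)
Definition len g := ex_minn (len_subproof g).

Lemma lenP g : exists2 w, size w = len g & g = sword w.
Proof.
rewrite /len; case: ex_minnP => m /existsP[w /eqP ->] _.
by exists w; rewrite ?size_tuple.
Qed.

Lemma len_le w : (len (sword w) <= size w)%N.
Proof.
rewrite /len; case: ex_minnP => m _; apply.
by apply/existsP; exists (in_tuple w).
Qed.

Lemma sword_cat u v : sword (u ++ v) = (sword u * sword v)%g.
Proof. exact: big_cat. Qed.

Lemma len1 : len 1%g = 0%N.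
Proof. by apply/eqP; rewrite -leqn0; have := len_le [::];
  rewrite /sword big_nil. Qed.

Lemma lenM g h : (len (g * h)%g <= len g + len h)%N.
Proof.
have [u <- ->] := lenP g; have [v <- ->] := lenP h.
by rewrite -sword_cat -size_cat len_le.
Qed.

Lemma len_simple i : (len (s i) <= 1)%N.
Proof. by have := len_le [:: i]; rewrite /sword big_seq1. Qed.

Lemma sword_ind (P : gT -> Prop) : P 1%g ->
  (forall i g, P g -> P (s i * g)%g) -> forall g, P g.
Proof.
move=> P1 PS g; have [w ->] := swordP g; elim: w => [|i w IH].
  by rewrite /sword big_nil.
by rewrite /sword big_cons; exact: PS.
Qed.

Lemma len_neq g i : len (g * s i)%g != len g.
Proof.
have [sg [sgM sgs]] := simple_sign.
have sg1 : sg 1%g = false by have := sgM 1%g 1%g; rewrite mulg1 addbb.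
have odd_len h : odd (len h) = sg h.
  have [w <- ->] := lenP h; elim: w => [|j w IH];
    first by rewrite /sword big_nil.
  by rewrite /= IH /sword big_cons sgM sgs.
apply/eqP => /(congr1 odd); rewrite !odd_len sgM sgs addbT.
by case: (sg g).
Qed.

Lemma mulsK g i : (g * s i * s i = g)%g.
Proof. by rewrite -mulgA sK mulg1. Qed.

Lemma lenS g i : len (g * s i)%g = (len g).+1 \/ len g = (len (g * s i)%g).+1.
Proof.
have h1 : (len (g * s i)%g <= (len g).+1)%N.
  by rewrite -addn1; apply: leq_trans (lenM _ _) _;
    rewrite leq_add2l len_simple.
have h2 : (len g <= (len (g * s i)%g).+1)%N.
  rewrite -addn1 -{1}(mulsK g i).
  by apply: leq_trans (lenM _ _) _; rewrite leq_add2l len_simple.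
have := len_neq g i; lia.
Qed.

Lemma len_last (g : gT) : g != 1%g -> exists i, len g = (len (g * s i)%g).+1.
Proof.
have [w] := lenP g; case/lastP: w => [|w i] sz ge;
  first by rewrite ge /sword big_nil eqxx.
move=> _; exists i; have := lenS g i.
have : (len (g * s i)%g <= size w)%N.
  by rewrite ge /sword big_rcons /= -/(sword w) mulsK len_le.
move=> le1 [] h; rewrite size_rcons in sz; lia.
Qed.

(** Alternating product of [k] simple reflections, whose last factor is [s j] when [k > 0]. *)
Fixpoint alt k i j : gT :=
  if k is k'.+1 then ((if odd k' then s i else s j) * alt k' i j)%g else 1%g.

Lemma len_alt k i j : (len (alt k i j) <= k)%N.
Proof.
elim: k => [|k IH] /=; first by rewrite len1.
by apply: leq_trans (lenM _ _) _; case: ifP => _; have := len_simple i;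
  have := len_simple j; lia.
Qed.

Lemma altSr k i j : alt k.+1 i j = (alt k j i * s j)%g.
Proof.
elim: k => [|k IH]; first by rewrite /= mulg1 mul1g.
rewrite [LHS]/= -/(alt k.+1 i j) IH /= mulgA.
by case: (odd k).
Qed.

(** Braid relation. The quotient of the two alternating products of length [k] is a [k]-th power of
    [s i * s j] or of [s j * s i], trivial when [k] is their order. *)
Lemma alt_swap i j : alt #[s i * s j]%g i j = alt #[s i * s j]%g j i.
Proof.
have swapX (a b : gT) k : (b * (a * b) ^+ k * a = (b * a) ^+ k.+1)%g.
  elim: k => [|k IH]; first by rewrite expg0 mulg1 expg1.
  by rewrite expgS [in RHS]expgS -IH !mulgA.
have key k : (alt k i j * (alt k j i)^-1)%g =
    if odd k then ((s j * s i) ^+ k)%g else ((s i * s j) ^+ k)%g.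
  elim: k => [|k IH]; first by rewrite /= invg1 mulg1 expg0.
  rewrite /= invMg mulgA -(mulgA _ (alt k i j)) IH.
  by case: (odd k) => /=; rewrite (simpleV (order_simple hW)) swapX.
apply/eqP; rewrite eq_mulgV1 key (order_simpleC (order_simple hW) i j).
by case: ifP; rewrite ?expg_order // (order_simpleC (order_simple hW))
  expg_order.
Qed.

End Words.

Section CoxeterGeometry.
Variables (R : realType) (gT : finGroupType) (n : nat) (s : 'I_n -> gT).
Hypothesis hW : coxeter_system s.
Variable Phi : gT -> 'M[R]_n.
Hypotheses (Phi1 : Phi 1%g = 1%:M)
  (PhiM : forall g h, Phi (g * h)%g = Phi g *m Phi h)
  (PhiS : forall i, Phi (s i) = simple_mx R s i).

Local Notation V := 'rV[R]_n.
Local Notation B := (@root_form gT n s R).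
Local Notation alpha := (@simple_root n R).
Local Notation rfl := (@rfl R gT n s).
Local Notation sK := (simpleK (order_simple hW)).
Local Notation BC := (@root_formC R gT n s (order_simple hW)).
Local Notation norm1 := (@simple_root_norm R gT n s (order_simple hW)).
Local Notation len := (len hW).

(** Matrices multiply rows on the right; the inverse turns this into a left action. *)
Definition act g (x : V) : V := x *m Phi (g^-1)%g.

Lemma act1 x : act 1%g x = x.
Proof. by rewrite /act invg1 Phi1 mulmx1. Qed.
Lemma actM g h x : act (g * h)%g x = act g (act h x).
Proof. by rewrite /act invMg PhiM mulmxA. Qed.
Lemma actD g x y : act g (x + y) = act g x + act g y.
Proof. exact: mulmxDl. Qed.
Lemma actZ g a x : act g (a *: x) = a *: act g x.
Proof. by rewrite /act scalemxAl. Qed.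
Lemma actN g x : act g (- x) = - act g x.
Proof. exact: mulNmx. Qed.
Lemma actK g x : act (g^-1)%g (act g x) = x.
Proof. by rewrite -actM mulVg act1. Qed.
Lemma actVK g x : act g (act (g^-1)%g x) = x.
Proof. by rewrite -actM mulgV act1. Qed.
Lemma act_simple i x : act (s i) x = rfl (alpha i) x.
Proof. by rewrite /act (simpleV (order_simple hW)) PhiS simple_mxE. Qed.

Lemma act_isom g x y : B (act g x) (act g y) = B x y.
Proof.
move: g; apply: (sword_ind hW) => [|i g IH]; first by rewrite !act1.
by rewrite !actM !act_simple rfl_isom ?norm1 //; exact: order_simple.
Qed.

Lemma act_adj g x y : B (act g x) y = B x (act (g^-1)%g y).
Proof. by rewrite -[in LHS](actVK g y) act_isom. Qed.

Lemma act_word w x : act (sword s w) x = foldr (@simple_act gT n s R) x w.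
Proof.
elim: w => [|i w IH]; first by rewrite /sword big_nil act1.
by rewrite /sword big_cons actM -/(sword s w) IH act_simple.
Qed.

Definition nnvec (v : V) := forall j, 0 <= v 0 j.

Lemma nnvec_comb a b u v : 0 <= a -> 0 <= b -> nnvec u -> nnvec v ->
  nnvec (a *: u + b *: v).
Proof. by move=> a0 b0 u0 v0 j; rewrite !mxE addr_ge0 // mulr_ge0. Qed.

Lemma nnvec_simple i : nnvec (alpha i).
Proof. by move=> j; rewrite mxE ler0n. Qed.

Lemma nnvec_anti v : nnvec v -> nnvec (- v) -> v = 0.
Proof.
move=> v0 v1; apply/rowP => j; rewrite mxE; apply: le_anti.
by rewrite v0 andbT -oppr_ge0; have := v1 j; rewrite mxE.
Qed.

(** Each further letter changes one of the two coordinates, by the recurrence [sin_step]. As long as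
    the multiples of the angle do not exceed [pi], both coordinates are nonnegative; this is the
    rank two case of the positivity of roots. *)
Lemma act_alt i j k : i != j ->
  let th := braid_angle R s i j in
  act (alt s k i j) (alpha i) = (sin th)^-1 *:
    (if odd k then sin (k%:R * th) *: alpha i + sin (k.+1%:R * th) *: alpha j
     else sin (k.+1%:R * th) *: alpha i + sin (k%:R * th) *: alpha j).
Proof.
move=> ij th.
have s0 : sin th != 0 by rewrite gt_eqF // sin_braid_angle_gt0.
have ab : B (alpha i) (alpha j) = - cos th by rewrite simple_root_form_angle.
have step l :
    sin (l.+2%:R * th) = 2 * cos th * sin (l.+1%:R * th) - sin (l%:R * th).
  have -> : l.+2%:R * th = l%:R * th + th + th by rewrite -[l.+2]addn2 natrD;
    ring.
  have -> : l.+1%:R * th = l%:R * th + th by rewrite -[l.+1]addn1 natrD; ring.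
  exact: sin_step.
elim: k => [|k IH].
  by rewrite /= act1 mul1r mul0r sin0 scale0r addr0 scalerA mulVf ?scale1r.
rewrite /= actM IH; case: (odd k) => /=.
  rewrite act_simple rflZ (@rfl_combl R gT n s (order_simple hW) _ _ th) ?norm1
    //.
  by rewrite -step.
rewrite act_simple rflZ (@rfl_combr R gT n s _ _ th) ?norm1 //.
by rewrite -step.
Qed.

(* Humphreys, Reflection groups and Coxeter groups, Theorem 5.4. *)
Lemma len_act_nneg (w : gT) i : (len w < len (w * s i)%g)%N ->
  nnvec (act w (alpha i)).
Proof.
have [N] := ubnP (len w); elim: N w i => // N IH w i lewN lti.
have [->|wN1] := eqVneq w 1%g; first by rewrite act1; exact: nnvec_simple.
have [j lj] := len_last hW wN1.
have ij : i != j by apply/eqP => e; move: lti; rewrite e ltnNge lj leqnSn.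
(* [Q k] says that [w] has a reduced expression ending with the letters of [alt s k i j]. *)
pose Q k := (len (w * (alt s k i j)^-1)%g + k)%N == len w.
have exQ : exists k, ~~ Q k.
  by exists (len w).+1; rewrite /Q; apply/eqP; lia.
set m := #[s i * s j]%g.
(* Otherwise the braid relation would give a reduced expression of [w] ending with [s i], against
   [lti]. *)
have Qm : ~~ Q m.
  apply/eqP => e; move: lti; rewrite ltnNge => /negP; apply.
  have m1 : (1 < m)%N := order_simple_gt1 hW ij.
  rewrite -e -{1}(mulgKV (alt s m i j) w) -/m alt_swap //.
  move: e; rewrite alt_swap // -/m; case: (m) m1 => // m' _ e.
  rewrite altSr mulgA (mulsK hW).
  apply: leq_trans (lenM hW _ _) _.
  by rewrite leq_add2l; apply: leq_trans (len_alt hW _ _ _) _; exact: leqnSn.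
case: (ex_minnP exQ) => k1 nQk1 mink.
have k1m : (k1 <= m)%N := mink _ Qm.
have {}mink k : (k < k1)%N -> Q k.
  by move=> kk; apply: contraLR kk => /mink; rewrite leqNgt.
have Q1 : Q 1%N.
  by rewrite /Q /= mulg1 (simpleV (order_simple hW)) addn1 -lj.
case: k1 nQk1 k1m mink => [|[|k]]; first by rewrite /Q /= invg1 mulg1 addn0
  eqxx.
  by rewrite Q1.
move=> nQ km mink.
have /eqP Qk := mink k.+1 (ltnSn _).
set v := (w * (alt s k.+1 i j)^-1)%g in Qk.
have wv : w = (v * alt s k.+1 i j)%g by rewrite mulgKV.
(* [a] is the first letter of the alternating word stripped from [w], [b] the letter that would
   prolong it on the left. Neither shortens [v], so the induction hypothesis applies to [v] and to
   both simple roots. *)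
pose a := if odd k then i else j; pose b := if odd k then j else i.
have altE : alt s k.+1 i j = (s a * alt s k i j)%g by rewrite /a /=; case: odd.
have vb : (len v < len (v * s b)%g)%N.
  move: nQ; rewrite /Q /= invMg mulgA.
  have -> : (if ~~ odd k then s i else s j) = s b by rewrite /b; case: odd.
  rewrite (simpleV (order_simple hW)) -/(alt s k.+1 i j) -/v.
  case: (lenS hW v b) => [->//|e] /eqP[]; by rewrite -Qk e addSnnS.
have va : (len v < len (v * s a)%g)%N.
  case: (lenS hW v a) => [->//|e].
  have : (len w <= len (v * s a)%g + k)%N.
    rewrite wv altE mulgA; apply: leq_trans (lenM hW _ _) _.
    by rewrite leq_add2l len_alt.
  by lia.
have lvN : (len v < N)%N by lia.
have [vi vj] : nnvec (act v (alpha i)) /\ nnvec (act v (alpha j)).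
  have := IH _ _ lvN va; have := IH _ _ lvN vb; rewrite /a /b.
  by case: (odd k).
set th := braid_angle R s i j.
have sn l : (l <= m)%N -> 0 <= sin (l%:R * th) / sin th.
  move=> lm; apply: divr_ge0; last exact: ltW (sin_braid_angle_gt0 R hW ij).
  apply: sin_ge0_pi.
  have th0 := ltW (braid_angle_gt0 R s i j).
  by rewrite mulr_ge0 //= -(braid_angle_pi R s i j) ler_wpM2r // ler_nat.
rewrite wv actM act_alt // -/th actZ.
have [p0 q0] : 0 <= sin (k.+1%:R * th) / sin th /\ 0 <= sin (k.+2%:R * th) / sin
  th.
  by split; apply: sn; lia.
case: (odd _); rewrite actD !actZ scalerDr !scalerA ![_^-1 * _]mulrC.
  exact: nnvec_comb.
exact: nnvec_comb.
Qed.

Lemma len_act_npos (w : gT) i : (len (w * s i)%g < len w)%N ->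
  nnvec (- act w (alpha i)).
Proof.
move=> h; have := @len_act_nneg (w * s i)%g i; rewrite (mulsK hW) => /(_ h).
by rewrite actM act_simple rfl_id ?norm1 // actN.
Qed.

Lemma root_dichotomy w i : nnvec (act w (alpha i)) \/ nnvec (- act w (alpha i)).
Proof.
by case: (lenS hW w i) => e; [left; apply: len_act_nneg | right;
  apply: len_act_npos]; rewrite e.
Qed.

(** A nontrivial element has a descent, and makes the corresponding simple root negative. *)
Lemma act_faithful w : (forall x, act w x = x) -> w = 1%g.
Proof.
move=> h; apply/eqP/negPn/negP => /(len_last hW)[i li].
have a0 : alpha i = 0.
  apply: nnvec_anti; first exact: nnvec_simple.
  by rewrite -(h (alpha i)); apply: len_act_npos; rewrite li.
by move: (norm1 i); rewrite a0 root_form0l => /eqP; rewrite eq_sym oner_eq0.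
Qed.

(** * Positive definiteness of the form *)

(** The standard inner product averaged over the finite group: invariant, and visibly positive
    definite. *)
Definition avg_form (x y : V) : R := \sum_(g : gT) (act g x *m (act g y)^T) 0 0.

Lemma avg_formDl x y z : avg_form (x + y) z = avg_form x z + avg_form y z.
Proof. by rewrite -big_split; apply: eq_bigr => g _;
  rewrite actD mulmxDl mxE. Qed.
Lemma avg_formZl a x z : avg_form (a *: x) z = a * avg_form x z.
Proof. by rewrite mulr_sumr; apply: eq_bigr => g _;
  rewrite actZ -scalemxAl mxE. Qed.
Lemma avg_formC x y : avg_form x y = avg_form y x.
Proof.
apply: eq_bigr => g _; rewrite !mxE; apply: eq_bigr => j _.
by rewrite !mxE mulrC.
Qed.
Lemma avg_form_suml (I : Type) (r : seq I) (P : pred I) (F : I -> V) w :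
  avg_form (\sum_(i <- r | P i) F i) w = \sum_(i <- r | P i) avg_form (F i) w.
Proof.
apply: (big_morph (avg_form^~ w)) => [x y|]; first exact: avg_formDl.
by rewrite -(scale0r (0 : V)) avg_formZl mul0r.
Qed.

Lemma avg_form_isom h x y : avg_form (act h x) (act h y) = avg_form x y.
Proof.
rewrite [RHS](reindex (fun g => (g * h)%g)) /=.
  by apply: eq_bigr => g _; rewrite !actM.
by exists (fun g => (g * h^-1)%g) => g _; rewrite ?mulgK ?mulgKV.
Qed.

Lemma avg_form_gt0 x : x != 0 -> 0 < avg_form x x.
Proof.
have sq (v : V) : (v *m v^T) 0 0 = \sum_j v 0 j ^+ 2.
  by rewrite mxE; apply: eq_bigr => j _; rewrite mxE expr2.
have ge0 (v : V) : 0 <= (v *m v^T) 0 0.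
  by rewrite sq; apply: sumr_ge0 => j _; rewrite sqr_ge0.
move=> x0; rewrite /avg_form (bigD1 1%g) //= act1 ltr_pwDl //; last first.
  by apply: sumr_ge0 => g _.
rewrite lt_def ge0 andbT sq; apply: contra x0 => /eqP e; apply/eqP/rowP => j.
rewrite mxE; apply/eqP; rewrite -sqrf_eq0; apply/eqP.
by apply: (psumr_eq0P _ e) => // i _; rewrite sqr_ge0.
Qed.

Lemma simple_root_neq0 i : alpha i != 0.
Proof.
apply/eqP => a0; move: (norm1 i); rewrite a0 root_form0l => /eqP.
by rewrite eq_sym oner_eq0.
Qed.

(** Invariance under [s i], which negates [alpha i], makes the two forms proportional against
    [alpha i]. *)
Lemma avg_form_simple i x :
  avg_form x (alpha i) = avg_form (alpha i) (alpha i) * B x (alpha i).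
Proof.
have := avg_form_isom (s i) x (alpha i).
rewrite !act_simple rfl_id ?norm1 // /rfl avg_formDl.
rewrite -!scaleNr avg_formZl !(avg_formC _ (- alpha i)) -!scaleN1r !avg_formZl.
by rewrite (avg_formC _ x); lra.
Qed.

(* Let [q_i] be the square norm of [alpha i] for [avg_form]. As [q_i = q_j]
   whenever [alpha i] and [alpha j] are not orthogonal, dividing [alpha i] by
   [sqrt q_i] turns [avg_form] into [B]. *)
Lemma root_form_gt0 x : x != 0 -> 0 < B x x.
Proof.
move=> x0; pose q i := avg_form (alpha i) (alpha i).
have q0 i : 0 < q i by exact: avg_form_gt0 (simple_root_neq0 i).
pose r i := Num.sqrt (q i).
have r0 i : 0 < r i by rewrite sqrtr_gt0.
have rr i : r i * r i = q i by rewrite -expr2 sqr_sqrtr // ltW.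
pose y : V := \sum_i (x 0 i / r i) *: alpha i.
have yE j : y 0 j = x 0 j / r j.
  rewrite /y summxE (bigD1 j) //= big1 => [|i ij]; rewrite !mxE !eqxx.
    by rewrite mulr1 addr0.
  by rewrite eq_sym (negPf ij) mulr0.
have y0 : y != 0.
  apply: contra x0 => /eqP e; apply/eqP/rowP => j; rewrite mxE.
  have := yE j; rewrite e mxE => /esym/eqP.
  by rewrite mulf_eq0 invr_eq0 (gt_eqF (r0 j)) orbF => /eqP.
suff -> : B x x = avg_form y y by exact: avg_form_gt0.
have BEr z : B z x = \sum_j x 0 j * B z (alpha j).
  rewrite {1}[x]row_sum_simple root_form_sumr.
  by apply: eq_bigr => j _; rewrite root_formZr.
have BEl z : B x z = \sum_j x 0 j * B (alpha j) z.
  rewrite {1}[x]row_sum_simple root_form_suml.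
  by apply: eq_bigr => j _; rewrite root_formZl.
rewrite BEl {1}/y avg_form_suml.
apply: eq_bigr => i _; rewrite avg_formZl.
rewrite BEr avg_formC avg_form_suml !mulr_sumr.
apply: eq_bigr => j _; rewrite avg_formZl avg_form_simple -/(q i).
have qB : q i * B (alpha j) (alpha i) = q j * B (alpha i) (alpha j).
  by rewrite /q -!avg_form_simple avg_formC.
rewrite (BC (alpha j)) in qB *.
have [->|B0] := eqVneq (B (alpha i) (alpha j)) 0; first by rewrite !mulr0.
have qq : q i = q j by apply: (mulIf B0).
have -> : r j = r i by rewrite /r qq.
rewrite -{1}(rr i); set b := B _ _; field; exact: lt0r_neq0.
Qed.

Lemma root_form_eq0 x : B x x = 0 -> x = 0.
Proof. by move=> e; apply/eqP/negPn/negP => /root_form_gt0; rewrite e ltxx. Qed.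

Lemma root_gram_unit : root_gram s R \in unitmx.
Proof.
rewrite -row_free_unit -kermx_eq0; apply/rowV0P => v /sub_kermxP e.
by apply: root_form_eq0; rewrite /root_form e mul0mx mxE.
Qed.

Lemma regular_dominant : exists lam : V, forall i, B lam (alpha i) = 1.
Proof.
exists (const_mx 1 *m invmx (root_gram s R)) => i.
by rewrite /root_form mulmxKV ?root_gram_unit // trmx_delta -colE !mxE.
Qed.

(** * Reflections and their positive roots *)

Local Notation T := (reflections s).
Local Notation rho := (@pos_root gT n s R).

Lemma reflectionP (t : gT) :
  reflect (exists g i, t = (g * s i * g^-1)%g) (t \in T).
Proof.
apply: (iffP imset2P) => [[i g _ _ ->]|[g [i ->]]].
  by exists (g^-1)%g, i; rewrite invgK conjgE mulgA.
by exists i (g^-1)%g; rewrite // conjgE invgK mulgA.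
Qed.

Lemma reflection_conj (t g : gT) : t \in T -> (g * t * g^-1)%g \in T.
Proof.
case/reflectionP => h [i ->]; apply/reflectionP; exists (g * h)%g, i.
by rewrite invMg !mulgA.
Qed.

Lemma simple_reflection i : s i \in T.
Proof. by apply/reflectionP; exists 1%g, i; rewrite invg1 mul1g mulg1. Qed.

Lemma reflectionK (t : gT) : t \in T -> (t * t = 1)%g.
Proof.
by case/reflectionP => g [i ->]; rewrite !mulgA mulgKV (mulsK hW) mulgV.
Qed.

Lemma reflectionV (t : gT) : t \in T -> (t^-1 = t)%g.
Proof. by move=> tT; apply: (mulgI t); rewrite mulgV reflectionK. Qed.

Lemma act_rfl g a x : act g (rfl a x) = rfl (act g a) (act g x).
Proof. by rewrite /rfl actD actN actZ act_isom. Qed.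

Lemma act_conj_simple g i x : act (g * s i * g^-1)%g x =
  rfl (act g (alpha i)) x.
Proof. by rewrite !actM act_simple act_rfl actVK. Qed.

Lemma pos_rootP (t : gT) : t \in T -> exists g i,
  [/\ t = (g * s i * g^-1)%g, rho t = act g (alpha i) & nnvec (rho t)].
Proof.
case/reflectionP => g [i ->{t}].
have [t v] : exists v : V, is_pos_root_of s (g * s i * g^-1)%g v.
  have [h|h] := root_dichotomy g i.
    have [w gw] := swordP hW g; exists (act g (alpha i)), i, w.
    by split; rewrite -/(sword s w) -?gw // -act_word -gw.
  (* Replacing [g] by [g * s i] keeps the reflection and negates the root. *)
  have [w gw] := swordP hW (g * s i)%g; exists (- act g (alpha i)), i, w.
  split; rewrite -/(sword s w) -?gw //.
    by rewrite invMg (simpleV (order_simple hW)) (mulsK hW) mulgA.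
  by rewrite -act_word -gw actM act_simple rfl_id ?norm1 // actN.
have [j [w]] := xgetPex 0 (ex_intro _ _ v).
rewrite -/(sword s w) -act_word -/(pos_root _ _) => -[e1 e2 e3].
by exists (sword s w), j.
Qed.

(** * Roots, stabilizers and reflection length *)

Lemma pos_root_nneg (t : gT) : t \in T -> nnvec (rho t).
Proof. by case/pos_rootP => g [i []]. Qed.

Lemma pos_root_norm (t : gT) : t \in T -> B (rho t) (rho t) = 1.
Proof. by case/pos_rootP => g [i [_ -> _]]; rewrite act_isom norm1. Qed.

Lemma act_reflection (t : gT) x : t \in T -> act t x = rfl (rho t) x.
Proof. by case/pos_rootP => g [i [-> -> _]]; rewrite act_conj_simple. Qed.

Lemma unit_neq0 (a : V) : B a a = 1 -> a != 0.
Proof.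
by move=> a1; apply/eqP => a0; move/eqP: a1;
  rewrite a0 root_form0l eq_sym oner_eq0.
Qed.

Lemma rfl_inj (a b : V) : B a a = 1 -> B b b = 1 -> nnvec a -> nnvec b ->
  (forall x, rfl a x = rfl b x) -> a = b.
Proof.
move=> a1 b1 a0 b0 /(_ b); rewrite rfl_id // /rfl => e.
have be : b = B b a *: a.
  apply/rowP => j; have := congr1 (fun v : V => v 0 j) e; rewrite !mxE; lra.
have /eqP : B b a ^+ 2 = 1 by move: b1; rewrite {1 2}be !root_formE a1 mulr1
  expr2.
rewrite sqrf_eq1 => /orP[]/eqP Bba; move: be;
  rewrite Bba ?scale1r // scaleN1r => be.
have a00 : a = 0 by apply: nnvec_anti => //; rewrite -be.
by have := unit_neq0 a1; rewrite a00 eqxx.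
Qed.

Lemma pos_root_uniq (t : gT) v : t \in T -> B v v = 1 -> nnvec v ->
  (forall x, act t x = rfl v x) -> rho t = v.
Proof.
move=> tT v1 v0 h; apply: rfl_inj; rewrite ?pos_root_norm //.
  exact: pos_root_nneg.
by move=> x; rewrite -h act_reflection.
Qed.

Lemma pos_root_simple i : rho (s i) = alpha i.
Proof.
apply: pos_root_uniq; rewrite ?norm1 ?simple_reflection //.
  exact: nnvec_simple.
by move=> x; rewrite act_simple.
Qed.

Lemma pos_root_conj (t g : gT) : t \in T -> nnvec (act g (rho t)) ->
  rho (g * t * g^-1)%g = act g (rho t).
Proof.
move=> tT v0; apply: pos_root_uniq => //; first exact: reflection_conj.
  by rewrite act_isom pos_root_norm.
by move=> x; rewrite !actM (act_reflection _ tT) act_rfl actVK.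
Qed.

Lemma act_pos_root (t g : gT) : t \in T ->
  act g (rho t) = rho (g * t * g^-1)%g \/ act g (rho t) =
    - rho (g * t * g^-1)%g.
Proof.
move=> tT; case/pos_rootP: (tT) => h [i [te re _]].
have [v0|v0] := root_dichotomy (g * h)%g i; rewrite actM -re in v0.
  by left; rewrite pos_root_conj.
right; rewrite -[LHS]opprK; congr (- _); apply/esym/pos_root_uniq => //.
- exact: reflection_conj.
- by rewrite root_formNl root_formNr opprK act_isom pos_root_norm.
- by move=> x; rewrite rflNa !actM (act_reflection _ tT) act_rfl actVK.
Qed.

Lemma pos_root_inj : {in T &, injective rho}.
Proof.
move=> t u tT uT e; apply: (mulIg (u^-1)%g); rewrite mulgV;
  apply: act_faithful => x.
by rewrite actM (act_reflection _ tT) e -(act_reflection _ uT) actVK.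
Qed.

(** * Dominant vectors and stabilizers *)

Lemma dominant_ge0 x v : (forall i, 0 <= B x (alpha i)) -> nnvec v ->
  0 <= B x v.
Proof.
move=> xd v0; rewrite [v]row_sum_simple root_form_sumr sumr_ge0 // => i _.
by rewrite root_formZr mulr_ge0.
Qed.

Lemma dominant_orth x v i : (forall i, 0 <= B x (alpha i)) -> nnvec v ->
  B x v = 0 -> B x (alpha i) != 0 -> v 0 i = 0.
Proof.
move=> xd v0; rewrite {1}[v]row_sum_simple root_form_sumr => e xi.
have h j : true -> 0 <= B x (v 0 j *: alpha j) by rewrite root_formZr mulr_ge0.
have /(_ i isT)/eqP := psumr_eq0P h e; rewrite root_formZr mulf_eq0 (negPf xi)
  orbF.
by move/eqP.
Qed.

(** Take the image of [x] with the largest product with the regular vector [lam]: applying [s i]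
    changes this product by [- 2 * B (act g x) (alpha i)], which cannot be positive. *)
Lemma dominant_conj x : exists g, forall i, 0 <= B (act g x) (alpha i).
Proof.
have [lam lamE] := regular_dominant.
pose f g := B (act g x) lam.
case: (@arg_maxP _ _ _ (1%g : gT) predT f isT) => g _ gmax; exists g => i.
have : B (act (s i * g)%g x) lam <= B (act g x) lam := gmax (s i * g)%g isT.
rewrite actM act_simple {1}/rfl root_formDl.
by rewrite root_formNl root_formZl (BC (alpha i)) lamE mulr1; lra.
Qed.

(** For a descent [i] of [z], the number [B x (alpha i)] equals [B x (act z (alpha i))], which is at
    most 0 as the root is negative. So [s i] fixes [x] and can be removed from [z]. *)
Lemma dominant_stab x z : (forall i, 0 <= B x (alpha i)) -> act z x = x ->
  z \in <<[set s i | i in [pred i | B x (alpha i) == 0]]>>%g.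
Proof.
move=> xd; have [N] := ubnP (len z); elim: N z => // N IH z lz zx.
have [->|z1] := eqVneq z 1%g; first exact: group1.
have [i li] := len_last hW z1.
have xi : B x (alpha i) = 0.
  apply: le_anti; rewrite xd andbT -(act_isom z) zx -oppr_ge0 -root_formNr.
  by apply: dominant_ge0 => //; apply: len_act_npos; rewrite li.
rewrite -(mulsK hW z i) groupM //.
  apply: IH; first by rewrite -ltnS -li.
  by rewrite actM act_simple rfl_eq.
by apply: mem_gen; apply: imset_f; rewrite inE xi.
Qed.

Lemma regular_stab x z : (forall i, 0 < B x (alpha i)) -> act z x = x ->
  z = 1%g.
Proof.
move=> xd zx; have := dominant_stab (fun i => ltW (xd i)) zx.
have -> : [set s i | i in [pred i | B x (alpha i) == 0]] = finset.set0.
  by apply/setP => g; rewrite inE; apply/imsetP => -[i]; rewrite inE gt_eqF.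
by rewrite gen0 => /set1P.
Qed.

Lemma seq_avoid (r : seq R) : exists e, e \notin r.
Proof.
exists (1 + \sum_(z <- r) `|z|); apply/negP => er.
have : `|1 + \sum_(z <- r) `|z| | <= \sum_(z <- r) `|z|.
  by rewrite [leRHS](big_rem _ er) /= lerDl sumr_ge0.
by rewrite ger0_norm ?addr_ge0 ?sumr_ge0 // gerDr ler10.
Qed.

(** Finitely many hyperplanes, none of them containing [F], do not cover [F]: on a line [x + e *: y]
    only finitely many values of [e] are bad. *)
Lemma generic_point (F : V -> Prop) (r : seq V) :
  F 0 -> (forall e x y, F x -> F y -> F (x + e *: y)) ->
  (forall a, a \in r -> exists2 x, F x & B x a != 0) ->
  exists2 x, F x & forall a, a \in r -> B x a != 0.
Proof.
move=> F0 FD; elim: r => [|a r IH] h; first by exists 0.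
have [|x Fx xr] := IH; first by move=> b br; apply: h; rewrite inE br orbT.
have [|y Fy ya] := h a; first by rewrite mem_head.
have [e er] := seq_avoid [seq - B x b / B y b | b <- a :: r].
exists (x + e *: y); first exact: FD.
move=> b; rewrite root_formDl root_formZl => bar.
have [yb|yb] := eqVneq (B y b) 0.
  rewrite yb mulr0 addr0; apply: xr; move: bar; rewrite inE => /orP[/eqP ba|//].
  by rewrite -ba yb eqxx in ya.
apply: contra er => /eqP e0; apply/mapP; exists b => //.
apply: (mulIf yb); rewrite divfK //; apply/eqP; rewrite -addr_eq0.
by rewrite addrC; apply/eqP.
Qed.

(* A weak form of Steinberg's theorem on stabilizers. *)
Lemma fixed_space_root (z : gT) : z != 1%g ->
  exists2 t, t \in T & forall x, act z x = x -> B x (rho t) = 0.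
Proof.
move=> z1; apply: contrapT => h; move/negP: z1; apply; apply/eqP.
(* Otherwise [z] would fix a vector orthogonal to no root; a dominant conjugate of it is regular,
   and its stabilizer is trivial. *)
have [||a|x zx xr] := @generic_point (fun x =>
  act z x = x) [seq rho t | t <- enum T].
- by rewrite /act mul0mx.
- by move=> e x y zx zy; rewrite actD actZ zx zy.
- move=> /mapP[t]; rewrite mem_enum => tT ->; apply: contrapT => h'; apply: h.
  exists t => // x zx; apply: contrapT => xt; apply: h'; exists x => //;
    exact/eqP.
have [g gd] := dominant_conj x.
have : (g * z * g^-1 = 1)%g.
  apply: (@regular_stab (act g x)); last by rewrite !actM actK zx.
  move=> i; rewrite lt_def gd andbT act_adj -pos_root_simple.
  have sT := simple_reflection i.
  have tT := reflection_conj (g^-1)%g sT.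
  have nz : B x (rho (g^-1 * s i * g^-1^-1)%g) != 0.
    by apply: xr; apply: map_f; rewrite mem_enum.
  by have [->|->] := act_pos_root (g^-1)%g sT; rewrite ?root_formNr ?oppr_eq0.
by move/(canRL (mulgK _))/(canRL (mulKg _)); rewrite mul1g invgK mulVg.
Qed.

(** * Reflection length as a codimension *)

(** Its row space is the image of [g - 1] and its kernel the fixed space of [g], so that [codim] is
    the codimension of the latter. *)
Definition move_mx g : 'M[R]_n := Phi (g^-1)%g - 1%:M.
Definition codim g := \rank (move_mx g).

Lemma move_mxE g x : x *m move_mx g = act g x - x.
Proof. by rewrite mulmxBr mulmx1. Qed.

Lemma codim_le_n g : (codim g <= n)%N. Proof. exact: rank_leq_row. Qed.

Lemma codim_eq0 (g : gT) : codim g = 0%N -> g = 1%g.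
Proof.
move/eqP; rewrite mxrank_eq0 => /eqP e; apply: act_faithful => x.
by apply/eqP; rewrite -subr_eq0 -move_mxE e mulmx0.
Qed.

Lemma codim1 : codim 1%g = 0%N.
Proof. by rewrite /codim /move_mx invg1 Phi1 subrr mxrank0. Qed.

Lemma Phi_unit g : Phi g \in unitmx.
Proof. by apply: (@mulmx1_unit _ _ _ (Phi (g^-1)%g) _).1;
  rewrite -PhiM mulgV. Qed.

Lemma codimM g h : (codim (g * h)%g <= codim g + codim h)%N.
Proof.
have -> : codim (g * h)%g = \rank (move_mx h *m Phi (g^-1)%g + move_mx g)%R.
  by rewrite /codim /move_mx invMg PhiM mulmxBl mul1mx subrKA.
apply: leq_trans (mxrank_add _ _) _.
by rewrite addnC leq_add2l mxrankM_maxl.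
Qed.

Lemma codimJ g h : codim (g * h * g^-1)%g = codim h.
Proof.
have -> : codim (g * h * g^-1)%g =
    \rank (Phi g *m move_mx h *m Phi (g^-1)%g).
  rewrite /codim /move_mx !invMg invgK !PhiM mulmxBr mulmxBl mulmx1 -(PhiM g
    (g^-1)%g) mulgV Phi1.
  by rewrite mulmxA.
by rewrite mxrankMfree ?row_free_unit ?Phi_unit // eqmxMfull // row_full_unit
  Phi_unit.
Qed.

(** By invariance of the form, the image of [z - 1] is orthogonal to the fixed space; by dimension
    it is the whole orthogonal complement. *)
Lemma root_in_move z t : t \in T -> (forall x, act z x = x ->
  B x (rho t) = 0) ->
  (rho t <= move_mx z)%MS.
Proof.
move=> tT h; set M := move_mx z; set G := root_gram s R.
set K := (kermx M *m G)^T.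
have KE y j : (y *m K) 0 j = B (row j (kermx M)) y.
  by rewrite /root_form -row_mul !mxE; apply: eq_bigr => k _;
    rewrite !mxE mulrC.
have fix_row j : act z (row j (kermx M)) = row j (kermx M).
  by apply/eqP; rewrite -subr_eq0 -move_mxE -/M -row_mul mulmx_ker row0.
have sub : (M <= kermx K)%MS.
  apply/sub_kermxP; apply/row_matrixP => i; rewrite row_mul row0.
  apply/rowP => j; rewrite [RHS]mxE KE rowE move_mxE.
  by rewrite root_formDr root_formNr -{1}fix_row act_isom subrr.
have prec_rank : \rank M = \rank (kermx K).
  rewrite mxrank_ker mxrank_tr mxrankMfree ?row_free_unit ?root_gram_unit //.
  by rewrite mxrank_ker subKn // rank_leq_row.
have [_ /esym] := mxrank_leqif_eq sub; rewrite prec_rank eqxx => /andP[_ subr].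
apply: submx_trans subr; apply/sub_kermxP/rowP => j.
by rewrite KE [RHS]mxE h.
Qed.

(** The root of [t] is orthogonal to the fixed space of [z], which [t * z] therefore still fixes.
    Moreover [y] and [act z y] have the same norm and differ by this root, so that [t] exchanges
    them and [t * z] fixes [y] as well. *)
Lemma codim_drop z t y : t \in T -> act z y - y = rho t ->
  (codim (t * z)%g < codim z)%N.
Proof.
move=> tT e.
have zy : act z y = y + rho t by rewrite -e addrC subrK.
have By : B y (rho t) = - 2^-1.
  have := act_isom z y y; rewrite zy !root_formE pos_root_norm //
    (BC (rho t) y).
  by lra.
have ty : act t y = y + rho t.
  by rewrite act_reflection // /rfl By mulrN mulfV ?pnatr_eq0 // scaleN1r opprK.
have fixy : act (t * z)%g y = y.
  by rewrite actM zy -ty -actM reflectionK // act1.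
have sub : (kermx (move_mx z) <= kermx (move_mx (t * z)%g))%MS.
  apply/row_subP => i; apply/sub_kermxP; rewrite move_mxE.
  set x := row i _.
  have zx : act z x = x.
    by apply/eqP; rewrite -subr_eq0 -move_mxE -row_mul mulmx_ker row0.
  rewrite actM zx act_reflection // rfl_eq ?subrr //.
  have := act_isom z x y; rewrite zx zy root_formDr.
  by move/(canRL (addKr _)) => ->; rewrite addNr.
have lt : (kermx (move_mx z) < kermx (move_mx (t * z)%g))%MS.
  rewrite ltmxE sub /=; apply/negP => sub'.
  have : (y <= kermx (move_mx z))%MS.
    by apply: submx_trans sub'; apply/sub_kermxP; rewrite move_mxE fixy subrr.
  by move/sub_kermxP; rewrite move_mxE e => /eqP;
    rewrite (negPf (unit_neq0 (pos_root_norm tT))).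
have := rank_ltmx lt; rewrite !mxrank_ker /codim.
by have := codim_le_n z; have := codim_le_n (t * z)%g; rewrite /codim; lia.
Qed.

Lemma codim_drop_root z t : t \in T -> (rho t <= move_mx z)%MS ->
  (codim (t * z)%g < codim z)%N.
Proof.
by move=> tT /submxP[y e]; apply: (@codim_drop z t y); rewrite // -move_mxE e.
Qed.

Lemma codim_reflection (t : gT) : t \in T -> codim t = 1%N.
Proof.
move=> tT; apply/eqP; rewrite eqn_leq; apply/andP; split; last first.
  rewrite lt0n; apply/eqP => /codim_eq0 t1.
  have := act_reflection (rho t) tT; rewrite rfl_id ?pos_root_norm // t1 act1.
  move=> e; have := pos_root_norm tT; rewrite -t1 in e;
    rewrite {1}e root_formNl.
  by rewrite pos_root_norm //; lra.
have -> : codim t = \rank (root_gram s R *m (rho t)^T *m (- 2 *: rho t)).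
  congr (\rank _); apply/row_matrixP => i; rewrite rowE move_mxE row_mul.
  rewrite act_reflection // /rfl addrC addKr rowE mulmxA.
  rewrite (mx11_scalar (_ *m _^T)) mul_scalar_mx scalerA -scaleNr.
  by rewrite mulrN mulrC.
by apply: leq_trans (mxrankM_maxr _ _) _; exact: rank_leq_row.
Qed.

Lemma codim_Tpow m (w : gT) : (w \in T ^+ m)%g -> (codim w <= m)%N.
Proof.
elim: m w => [|m IH] w; first by rewrite expg0 => /set1P ->; rewrite codim1.
rewrite expgS => /mulsgP[t u tT uT ->].
apply: leq_trans (codimM _ _) _; rewrite codim_reflection // add1n ltnS.
exact: IH.
Qed.

Lemma reflection_drop (z : gT) : z != 1%g ->
  exists2 t, t \in T & (codim (t * z)%g < codim z)%N.
Proof.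
case/fixed_space_root => t tT h; exists t => //.
by apply: codim_drop_root => //; exact: root_in_move.
Qed.

(** Reflections from [reflection_drop] bring [w] to 1 in at most [codim w] steps, and [codim_Tpow]
    forbids fewer. *)
Lemma mem_Tpow_codim (w : gT) : (w \in T ^+ (codim w))%g.
Proof.
suff h N : forall w : gT, (codim w <= N)%N ->
  exists2 m, (m <= codim w)%N & (w \in T ^+ m)%g.
  have [m mw wm] := h _ _ (leqnn (codim w)).
  by have -> : codim w = m by apply/eqP; rewrite eqn_leq mw codim_Tpow.
elim: N {w} => [|N IH] w.
  rewrite leqn0 => /eqP w0; exists 0%N => //.
  by rewrite (codim_eq0 w0) expg0 set11.
move=> wN; have [->|w1] := eqVneq w 1%g.
  by exists 0%N => //; rewrite expg0 set11.
have [t tT lt] := reflection_drop w1.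
have [|m mc mT] := IH (t * w)%g; first exact: leq_trans lt wN.
exists m.+1; first exact: leq_ltn_trans mc lt.
by rewrite expgS; apply/mulsgP; exists t (t * w)%g;
  rewrite // mulgA reflectionK // mul1g.
Qed.

(** The search in [refl_length] stops at [#|gT|], which must exceed every codimension. *)
Lemma card_gt_n : (n < #|gT|)%N.
Proof.
rewrite -cardsT (cardsD1 1%g) inE add1n ltnS -[X in (X <= _)%N]card_ord.
rewrite -(card_imset _ (simple_inj hW)) subset_leq_card //.
apply/fintype.subsetP => g /imsetP[i _ ->]; rewrite !inE andbT.
by rewrite -order_eq1 order_simple.
Qed.

Lemma refl_lengthE (w : gT) : refl_length s w = codim w.
Proof.
rewrite /refl_length.
have lt : (codim w < #|gT|)%N := leq_ltn_trans (codim_le_n w) card_gt_n.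
set P := fun m => _; set r := iota 0 #|gT|.
have hasP : has P r.
  by apply/hasP; exists (codim w); rewrite ?mem_iota ?add0n //;
    exact: mem_Tpow_codim.
apply/eqP; rewrite eqn_leq; apply/andP; split.
  rewrite leqNgt; apply/negP => /(before_find 0%N).
  by rewrite nth_iota // add0n /P mem_Tpow_codim.
have := nth_find 0%N hasP; rewrite nth_iota ?add0n; last first.
  by move: hasP; rewrite has_find size_iota.
exact: codim_Tpow.
Qed.

Lemma reflection_of_codim1 (w : gT) : codim w = 1%N -> w \in T.
Proof. by move=> e; have := mem_Tpow_codim w; rewrite e expg1. Qed.

Lemma sign_codim : exists sg : gT -> bool, [/\
  forall g h, sg (g * h)%g = sg g (+) sg h & forall t, t \in T -> sg t].
Proof.
have [sg [sgM sgs]] := simple_sign hW; exists sg; split=> // t.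
case/reflectionP => g [i ->]; rewrite !sgM sgs.
have : sg (g * g^-1)%g = false.
  by rewrite mulgV; have := sgM 1%g 1%g; rewrite mulg1 addbb.
by rewrite sgM; case: (sg g); case: (sg _).
Qed.

Lemma reflectionM_notin (t u : gT) : t \in T -> u \in T -> (t * u)%g \notin T.
Proof.
move=> tT uT; have [sg [sgM sgT]] := sign_codim.
by apply/negP => /sgT; rewrite sgM !sgT.
Qed.

Lemma codim_reflection2 (t u : gT) : t \in T -> u \in T -> t != u ->
  codim (t * u)%g = 2%N.
Proof.
move=> tT uT tu; have le2 : (codim (t * u)%g <= 2)%N.
  by apply: leq_trans (codimM _ _) _; rewrite !codim_reflection.
have n0 : codim (t * u)%g != 0%N.
  apply: contra tu => /eqP/codim_eq0 e.
  by apply/eqP; apply: (mulIg u); rewrite e reflectionK.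
have n1 : codim (t * u)%g != 1%N.
  by apply: contra (reflectionM_notin tT uT) => /eqP/reflection_of_codim1.
by case: (codim _) le2 n0 n1 => [|[|[|]]].
Qed.

(* Carter's lemma for two letters. *)
Lemma move_mx2 (t u : gT) : t \in T -> u \in T -> t != u ->
  (move_mx (t * u)%g :=: col_mx (rho t) (rho u))%MS.
Proof.
move=> tT uT tu; apply/eqmxP.
have sub : (move_mx (t * u)%g <= col_mx (rho t) (rho u))%MS.
  apply/row_subP => i; rewrite rowE move_mxE actM act_reflection //.
  set x := delta_mx _ _; set y := act u x; rewrite /rfl.
  have -> : y = x - (2 * B x (rho u)) *: rho u by rewrite /y act_reflection.
  set a := 2 * B x _; set b := 2 * _.
  rewrite (_ : _ - x = (- a) *: rho u + (- b) *: rho t); last first.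
    by apply/rowP => j; rewrite !mxE; ring.
  rewrite -addsmxE addmx_sub // scalemx_sub // ?addsmxSl ?addsmxSr //.
rewrite sub /=; have [_ /esym] := mxrank_leqif_eq sub.
rewrite -/(codim _) codim_reflection2 // => e.
have : (\rank (col_mx (rho t) (rho u)) <= 2)%N by exact: rank_leq_row.
have := mxrankS sub; rewrite -/(codim _) codim_reflection2 // => h1 h2.
by move: e; rewrite eqn_leq h1 h2 => /andP[].
Qed.

(** * The Wall form of a Coxeter element *)

(** Some [y] is fixed by [t * z] but not by [z]. Then [act z y = act t y], so that [act z y - y] is
    a nonzero multiple of the root of [t]. *)
Lemma codim_drop_conv z t : t \in T -> (codim (t * z)%g < codim z)%N ->
  exists y, act z y - y = rho t.
Proof.
move=> tT lt.
have /row_subPn[i] : ~~ (kermx (move_mx (t * z)%g) <= kermx (move_mx z))%MS.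
  apply/negP => /mxrankS; rewrite !mxrank_ker; move: lt; rewrite /codim.
  by have := codim_le_n z; have := codim_le_n (t * z)%g; rewrite /codim; lia.
set y := row i _ => ny.
have fixy : act (t * z)%g y = y.
  by apply/eqP; rewrite -subr_eq0 -move_mxE -row_mul mulmx_ker row0.
have zy : act z y - y = - (2 * B y (rho t)) *: rho t.
  rewrite -[act z y]act1 -(reflectionK tT) actM -actM -actM.
  by rewrite -mulgA actM fixy act_reflection // /rfl addrC addKr scaleNr.
have k0 : - (2 * B y (rho t)) != 0.
  apply: contra ny => /eqP k0; apply/sub_kermxP.
  by rewrite move_mxE zy k0 scale0r.
exists ((- (2 * B y (rho t)))^-1 *: y).
by rewrite actZ -scalerBr zy scalerA mulVf // scale1r.
Qed.

Lemma act_sword_coord w x i : i \notin w -> act (sword s w) x 0 i = x 0 i.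
Proof.
elim: w => [|j w IH]; first by rewrite /sword big_nil act1.
rewrite inE negb_or => /andP[ij iw]; rewrite /sword big_cons -/(sword s w) actM.
rewrite act_simple /rfl !coordE IH // [alpha j 0 i]mxE eqxx /=.
by rewrite (negPf ij) mulr0 subr0.
Qed.

(** Among distinct letters only [s j] changes the coordinate [j]. A vector fixed by the word is thus
    orthogonal to the root of the first letter, hence fixed by the rest of the word. *)
Lemma fixed_sword w x : uniq w -> act (sword s w) x = x ->
  forall i, i \in w -> B x (alpha i) = 0.
Proof.
elim: w => [|j w IH] //= /andP[jw uw]; rewrite /sword big_cons -/(sword s w).
rewrite actM => e.
have e' : act (sword s w) x = rfl (alpha j) x.
  by rewrite -[LHS](rflK (norm1 j)) -(act_simple j (act _ x)) e.
have xj : B x (alpha j) = 0.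
  have := act_sword_coord x jw; rewrite e' /rfl !coordE [alpha j 0 j]mxE !eqxx
    mulr1.
  by lra.
move=> i; rewrite inE => /orP[/eqP->//|]; apply: IH => //.
by rewrite e' rfl_eq.
Qed.

Variable c : gT.
Hypothesis hc : coxeter_element s c.

Lemma fixed_coxeter_element x : act c x = x -> x = 0.
Proof.
have [p cE] := hc.
have {}cE : c = sword s [seq p i | i <- index_enum 'I_n] by rewrite /sword
  big_map.
rewrite cE => /fixed_sword h; apply: root_form_eq0.
rewrite {2}[x]row_sum_simple root_form_sumr big1 // => i _;
  rewrite root_formZr h ?mulr0 //.
  by rewrite map_inj_uniq ?index_enum_uniq //; exact: perm_inj.
by rewrite -[i](permKV p) map_f // mem_index_enum.
Qed.

Lemma move_coxeter_unit : move_mx c \in unitmx.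
Proof.
rewrite -row_free_unit -kermx_eq0; apply/rowV0P => v /sub_kermxP.
by rewrite move_mxE => /eqP; rewrite subr_eq0 => /eqP/fixed_coxeter_element.
Qed.

Lemma codim_coxeter : codim c = n.
Proof. exact: mxrank_unit move_coxeter_unit. Qed.

Definition wall_vec (v : V) : V := v *m invmx (move_mx c).

Lemma act_wall_vec v : act c (wall_vec v) = wall_vec v + v.
Proof.
rewrite -[act c _](subrK (wall_vec v)) -move_mxE mulmxKV ?move_coxeter_unit //.
exact: addrC.
Qed.

Definition chi (u v : V) : R := B (wall_vec u) v.

(** Invariance of the form under [c], written on Wall vectors. For roots it gives
    [chi v v = - 2^-1], and it translates the vanishing of [chi u v] into a condition on
    [chi v u]. *)
Lemma chi_anti u v : chi u v + chi v u = - B u v.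
Proof.
have := act_isom c (wall_vec u) (wall_vec v).
rewrite !act_wall_vec !root_formE /chi (BC u (wall_vec v)); lra.
Qed.

Lemma chi_norm v : B v v = 1 -> chi v v = - 2^-1.
Proof. by have := chi_anti v v; lra. Qed.

Lemma chi_root_neq0 v : B v v = 1 -> chi v v != 0.
Proof. by move=> /chi_norm ->; rewrite oppr_eq0 invr_eq0 pnatr_eq0. Qed.

Lemma chi_combl a b u v w : chi (a *: u + b *: v) w = a * chi u w + b * chi v w.
Proof.
by rewrite /chi /wall_vec mulmxDl -!scalemxAl root_formDl !root_formZl.
Qed.

Local Notation wp r := (\prod_(t <- r) val t)%g.
Local Notation rt t := (rho (val t)).
Implicit Types (r : seq (refl s)) (t u : refl s).

Lemma reflT t : val t \in T. Proof. exact: valP t. Qed.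
Lemma reflK t : (val t * val t = 1)%g. Proof. exact: reflectionK (reflT t). Qed.
Lemma reflV t : ((val t)^-1 = val t)%g. Proof. exact: reflectionV (reflT t).
  Qed.
Lemma rt_norm t : B (rt t) (rt t) = 1. Proof. exact: pos_root_norm (reflT t).
  Qed.

(* [r] is a reduced word of an element of NC; see [ncwP]. *)
Definition ncw r := (codim ((wp r)^-1 * c)%g + size r == n)%N.

Lemma codim_wp r : (codim (wp r) <= size r)%N.
Proof.
elim: r => [|t r IH]; first by rewrite big_nil codim1.
rewrite big_cons; apply: leq_trans (codimM _ _) _.
by rewrite codim_reflection ?reflT.
Qed.

Lemma ncw_ge r : (n <= codim ((wp r)^-1 * c)%g + size r)%N.
Proof.
rewrite -[X in (X <= _)%N]codim_coxeter -{1}(mulKVg (wp r) c).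
by apply: leq_trans (codimM _ _) _; rewrite addnC leq_add2l codim_wp.
Qed.

Lemma ncwP r : ncw r = abs_le s (wp r) c && (refl_length s (wp r) == size r).
Proof.
rewrite /ncw /abs_le !refl_lengthE codim_coxeter.
have key (a b m N : nat) : (a <= m -> N <= a + b ->
    (b + m == N) = (a + b == N) && (a == m))%N by lia.
apply: key (codim_wp r) _; rewrite -[X in (X <= _)%N]codim_coxeter.
by rewrite -{1}(mulKVg (wp r) c) codimM.
Qed.

Lemma ncw_full r : (wp r == c) && (size r == n) = ncw r && (size r == n).
Proof.
rewrite /ncw; apply/andP/andP => -[/eqP h /eqP sz]; split=> //; try exact/eqP.
  by rewrite h mulVg codim1 add0n sz.
have /codim_eq0 e : codim ((wp r)^-1 * c)%g = 0%N.
  by apply/eqP; rewrite -(eqn_add2r (size r)) h sz.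
by rewrite -[X in _ == X](mulKVg (wp r)) e mulg1.
Qed.

(** Each letter of [r'] missing from [r], moved to the front by conjugation, costs one
    reflection. *)
Lemma codim_subseq r r' : subseq r r' ->
  (codim ((wp r)^-1 * wp r')%g + size r <= size r')%N.
Proof.
elim: r' r => [|t r' IH] r.
  by rewrite subseq0 => /eqP ->; rewrite !big_nil invg1 mulg1 codim1.
case: r => [|u r] /=; first by rewrite big_nil invg1 mul1g addn0 codim_wp.
case: eqP => [->|_] h.
  rewrite !big_cons invMg -mulgA mulKg addnS; exact: IH.
have := IH _ h; set w := wp (u :: r); move=> le1.
have -> : (w^-1 * wp (t :: r'))%g = ((w^-1 * val t * w^-1^-1) * (w^-1 * wp
  r'))%g.
  by rewrite big_cons invgK !mulgA mulgK.
apply: leq_trans (leq_add (codimM _ _) (leqnn _)) _.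
by rewrite codimJ codim_reflection ?reflT // -addnA add1n ltnS.
Qed.

Lemma ncw_subseq r r' : subseq r r' -> ncw r' -> ncw r.
Proof.
move=> /codim_subseq h /eqP r'n; rewrite /ncw eqn_leq ncw_ge andbT -[X in (_ <=
  X)%N]r'n.
have -> : ((wp r)^-1 * c)%g = ((wp r)^-1 * wp r' * ((wp r')^-1 * c))%g.
  by rewrite mulgA mulgK.
apply: leq_trans (leq_add (codimM _ _) (leqnn _)) _.
by rewrite addnAC addnC leq_add2l.
Qed.

Lemma act_wp_fix r x : (forall t, t \in r -> B x (rt t) = 0) ->
  act (wp r)^-1%g x = x.
Proof.
move=> h; suff e : act (wp r) x = x by rewrite -{1}e actK.
elim: r h => [|t r IH] h; first by rewrite big_nil act1.
rewrite big_cons actM IH => [|u ur]; last by apply: h; rewrite inE ur orbT.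
by rewrite act_reflection ?reflT // rfl_eq // h ?mem_head.
Qed.

(** Some [z] is moved by [val t * c] exactly by the root of [u]. Inverting [c - 1] writes [z] as a
    combination of the Wall vectors of both roots; its coefficient [mu] also depends on [z], and the
    resulting equation in [mu] forces [chi] to vanish. *)
Lemma ncw_pair t u : ncw [:: t; u] -> chi (rt t) (rt u) = 0.
Proof.
move=> /eqP; rewrite big_cons big_seq1 invMg !reflV -mulgA /= => e.
have lt : (codim (val u * (val t * c))%g < codim (val t * c)%g)%N.
  by have := ncw_ge [:: t]; rewrite big_seq1 reflV /= -[X in (X <= _)%N]e addn2
    addn1 ltnS.
have [z zE] := codim_drop_conv (reflT u) lt.
set v1 := rt t in zE *; set v2 := rt u in zE *.
have cz : act c z = rfl v1 (z + v2).
  have -> : z + v2 = rfl v1 (act c z) by rewrite -zE subrKC actM act_reflection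
    ?reflT.
  by rewrite (rflK (rt_norm t)).
set mu := 2 * B (z + v2) v1.
have zw : z = wall_vec v2 - mu *: wall_vec v1.
  apply/eqP; rewrite -subr_eq0; apply/eqP; apply: fixed_coxeter_element.
  rewrite !(actD, actN, actZ) cz !act_wall_vec /rfl -/mu.
  by apply/rowP => j; rewrite !coordE !mxE; ring.
have := chi_anti v1 v2; have := chi_norm (rt_norm t); rewrite -/v1.
have : mu = 2 * B (z + v2) v1 by [].
rewrite {1}zw !root_formE -/(chi v2 v1) -/(chi v1 v1) (BC v1 v2) => h1 h2 h3.
by rewrite h2 in h1; lra.
Qed.

Lemma ncw_pairwise r : ncw r = pairwise (fun t u => chi (rt t) (rt u) == 0) r.
Proof.
apply/idP/idP => [nr|].
  elim: r nr => //= t r IH nr; apply/andP; split.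
    apply/allP => u ur; apply/eqP/ncw_pair/(ncw_subseq _ nr).
    by rewrite /= eqxx sub1seq.
  by apply: IH; apply: ncw_subseq nr; exact: subseq_cons.
elim/last_ind: r => [|r t IH]; first by rewrite /ncw big_nil invg1 mul1g addn0
  codim_coxeter.
rewrite pairwise_rcons => /andP[/allP al /IH /eqP nr].
rewrite /ncw eqn_leq ncw_ge andbT size_rcons.
(* The Wall vector of the root of [t] is the witness: [c] adds this root to it, and the sum is
   orthogonal to all letters of [r] since [chi] vanishes on them, so [(wp r)^-1] fixes the sum. *)
have lt : (codim (val t * ((wp r)^-1 * c))%g < codim ((wp r)^-1 * c)%g)%N.
  apply: (codim_drop (y := wall_vec (rt t)) (reflT t)).
  rewrite actM act_wall_vec act_wp_fix; first by rewrite addrAC subrr add0r.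
  move=> u ur.
  by have /eqP := al _ ur; have := chi_anti (rt u) (rt t);
    rewrite /chi root_formDl (BC (rt t)); lra.
have -> : (wp (rcons r t))^-1%g = (val t * (wp r)^-1)%g.
  by rewrite -cats1 big_cat big_seq1 /= invMg reflV.
by rewrite -mulgA -[X in (_ <= X)%N]nr addnS -addSn leq_add2r.
Qed.

(** * Parabolic subgroups of rank two *)

Lemma abs_le_root (r w : gT) : r \in T -> abs_le s r w =
  (rho r <= move_mx w)%MS.
Proof.
move=> rT; rewrite /abs_le !refl_lengthE codim_reflection // reflectionV //.
have le : (codim w <= 1 + codim (r * w)%g)%N.
  rewrite -(codim_reflection rT) -{1}(mulKg r w) reflectionV //; exact: codimM.
rewrite eqn_leq le andbT add1n.
apply/idP/idP => [/codim_drop_conv-/(_ rT)[y <-]|]; last exact: codim_drop_root.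
by rewrite -move_mxE submxMl.
Qed.

Lemma sub_col_mx2 (u v x : V) : (x <= col_mx u v)%MS ->
  exists p q, x = p *: u + q *: v.
Proof.
rewrite -addsmxE => /sub_addsmxP[[p q] ->]; exists (p 0 0), (q 0 0).
by rewrite [p in LHS]mx11_scalar [q in LHS]mx11_scalar !mul_scalar_mx.
Qed.

Lemma nnvec_line i v : nnvec v -> B v v = 1 -> (forall j, j != i ->
  v 0 j = 0) -> v = alpha i.
Proof.
move=> v0 v1 h.
have ve : v = v 0 i *: alpha i.
  rewrite {1}[v]row_sum_simple (bigD1 i) //= big1 ?addr0 // => j ji.
  by rewrite h // scale0r.
move: v1; rewrite ve !root_formE norm1 mulr1 -expr2 => /eqP.
by rewrite sqrp_eq1 // => /eqP ->; rewrite scale1r.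
Qed.

Section RankTwoFrame.
Variable w : gT.
Hypothesis w2 : exists t u : gT, [/\ t \in T, u \in T, t != u & w = (t * u)%g].

Lemma rank2_codim : codim w = 2%N.
Proof. by have [t [u [tT uT tu ->]]] := w2; rewrite codim_reflection2. Qed.

(** [generic_point] avoids the roots outside the image of [w - 1]; those inside are orthogonal to
    every fixed vector. *)
Lemma generic_fixed : exists2 x, act w x = x &
  forall r : gT, r \in T -> (B x (rho r) == 0) = (rho r <= move_mx w)%MS.
Proof.
pose L := [seq rho r | r : gT <- enum T & ~~ (rho r <= move_mx w)%MS].
have [||a|x wx xr] := @generic_point (fun x => act w x = x) L.
- by rewrite /act mul0mx.
- by move=> e x y zx zy; rewrite actD actZ zx zy.
- move=> /mapP[t]; rewrite mem_filter mem_enum => /andP[tN tT] ->.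
  apply: contrapT => h; move/negP: tN; apply; apply: root_in_move => // x wx.
  by apply: contrapT => xt; apply: h; exists x => //; exact/eqP.
exists x => // r rT; apply/idP/idP => [|/submxP[y ->]]; last first.
  by rewrite move_mxE root_formDr root_formNr -{1}wx act_isom subrr.
apply: contraLR => rN; apply: xr; apply: map_f.
by rewrite mem_filter rN mem_enum.
Qed.

(** The roots in the image of [w - 1] are those orthogonal to a generic fixed vector [x]. Once [x]
    is carried to a dominant vector [y], they become the roots of the standard parabolic subgroup
    fixing [y], of rank two. Conjugating back by an arbitrary [g] could spoil positivity, whence the
    extremal choice of [g]. *)
Lemma rank2_frame : exists (g : gT) (i j : 'I_n), [/\ i != j,
  nnvec (act (g^-1)%g (alpha i)), nnvec (act (g^-1)%g (alpha j)),
  (forall r : gT, r \in T -> (r \in <<[set s i;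
    s j]>> :^ g)%g = (rho r <= move_mx w)%MS) &
  (forall r : gT, r \in T -> (rho r <= move_mx w)%MS -> exists p q : R,
     [/\ 0 <= p, 0 <= q & rho r = p *: act (g^-1)%g (alpha i) +
       q *: act (g^-1)%g (alpha j)])].
Proof.
have [x wx xE] := generic_fixed.
have [g0 yd] := dominant_conj x; set y := act g0 x in yd.
have [lam lamE] := regular_dominant.
have lamd i : 0 <= B lam (alpha i) by rewrite lamE.
pose f g := B (act g lam) lam.
(* If [g^-1] made negative a simple root [alpha i] orthogonal to [y], then [s i * g] would still
   carry [x] to [y] and give a larger value of [f]. *)
have [g gx gmax] : exists2 g : gT, act g x = y &
    forall h : gT, act h x = y -> f h <= f g.
  case: (@arg_maxP _ _ _ g0 (fun h => act h x == y) f (eqxx y)) =>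
    g /eqP gx gmax.
  by exists g => // h /eqP; exact: gmax.
have Q1 i : B y (alpha i) = 0 -> nnvec (act (g^-1)%g (alpha i)).
  move=> yi; have [//|neg] := root_dichotomy (g^-1)%g i.
  have le : f (s i * g)%g <= f g.
    by apply: gmax; rewrite actM gx act_simple rfl_eq.
  move: le; rewrite /f actM act_simple {1}/rfl root_formDl root_formNl
    root_formZl.
  rewrite (BC (alpha i)) lamE mulr1 (act_adj g lam (alpha i)) => le.
  have ge : 0 <= B lam (- act (g^-1)%g (alpha i)) by exact: dominant_ge0.
  have z : B lam (- act (g^-1)%g (alpha i)) = 0.
    by move: ge; rewrite root_formNr; lra.
  suff v0 : - act (g^-1)%g (alpha i) = 0.
    have := unit_neq0 (a := act (g^-1)%g (alpha i)).
    by rewrite act_isom norm1 -oppr_eq0 v0 eqxx => /(_ erefl).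
  apply/rowP => j; rewrite [RHS]mxE; apply: (dominant_orth lamd neg z).
  by rewrite lamE oner_eq0.
have Q2 (r : gT) k : r \in T -> (rho r <= move_mx w)%MS -> B y (alpha k) != 0 ->
    act g (rho r) 0 k = 0.
  move=> rT rw yk.
  have By : B y (act g (rho r)) = 0 by rewrite -gx act_isom; apply/eqP;
    rewrite xE.
  have rT' := reflection_conj g rT.
  have := dominant_orth (i := k) yd (pos_root_nneg rT').
  have [e|e] := act_pos_root g rT; rewrite e in By *;
    first by move=> /(_ By yk).
  by rewrite coordN => ->; rewrite ?oppr0 //; move: By; rewrite root_formNr;
    lra.
have Q3 i : B y (alpha i) = 0 -> (g^-1 * s i * g^-1^-1)%g \in T /\
    rho (g^-1 * s i * g^-1^-1)%g = act (g^-1)%g (alpha i).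
  move=> yi; have sT := simple_reflection i; split;
    first exact: reflection_conj.
  by rewrite pos_root_conj // pos_root_simple //; exact: Q1.
have Q4 i : B y (alpha i) = 0 -> (act (g^-1)%g (alpha i) <= move_mx w)%MS.
  by move=> yi; have [iT <-] := Q3 _ yi; rewrite -xE // (Q3 _ yi).2 -act_adj gx
    yi.
(* With fewer than two simple roots orthogonal to [y], the images under [g] of the roots of [t] and
   [u] would lie on one line. *)
have [i [j [ij yi yj]]] : exists i j, [/\ i != j,
  B y (alpha i) = 0 & B y (alpha j) = 0].
  apply: contrapT => noij.
  have [t [u [tT uT tu wE]]] := w2.
  have tw : (rho t <= move_mx w)%MS by rewrite wE move_mx2 // -addsmxE addsmxSl.
  have uw : (rho u <= move_mx w)%MS by rewrite wE move_mx2 // -addsmxE addsmxSr.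
  have exi : exists i, B y (alpha i) = 0.
    apply: contrapT => noi; have := rt_norm (exist _ t tT); rewrite /= => n1.
    have z : act g (rho t) = 0.
      apply/rowP => k; rewrite [RHS]mxE; apply: Q2 => //.
      by apply/eqP => yk; apply: noi; exists k.
    by have := unit_neq0 (a := act g (rho t));
      rewrite act_isom n1 z eqxx => /(_ erefl).
  have [i yi] := exi.
  have line (r : gT) : r \in T -> (rho r <= move_mx w)%MS ->
    rho (g * r * g^-1)%g = alpha i.
    move=> rT rw; have rT' := reflection_conj g rT.
    apply: nnvec_line; [exact: pos_root_nneg | exact: pos_root_norm |] => j ji.
    have yj : B y (alpha j) != 0.
      by apply/eqP => yj; apply: noij; exists i, j; split; rewrite // eq_sym.
    have := Q2 _ _ rT rw yj.
    by have [->|->] := act_pos_root g rT; rewrite // coordN => /eqP;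
      rewrite oppr_eq0 => /eqP.
  have := line _ uT uw; rewrite -(line _ tT tw).
  move/(pos_root_inj (reflection_conj g uT) (reflection_conj g tT)).
  by move/mulIg/mulgI => e; rewrite e eqxx in tu.
have [aT aE] := Q3 _ yi; have [bT bE] := Q3 _ yj.
set a := (g^-1 * s i * _)%g in aT aE; set b := (g^-1 * s j * _)%g in bT bE.
have ab : a != b.
  by apply: contra ij => /eqP/mulIg/mulgI/(simple_inj hW) ->.
have subE : (move_mx w <= col_mx (rho a) (rho b))%MS.
  have sub : (col_mx (rho a) (rho b) <= move_mx w)%MS.
    by rewrite -addsmxE addsmx_sub aE bE !Q4.
  have [_ /esym] := mxrank_leqif_eq sub; rewrite -/(codim w) rank2_codim.
  have -> : \rank (col_mx (rho a) (rho b)) = 2%N.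
    by rewrite -(eqmx_rank (introT eqmxP (move_mx2 aT bT ab)));
      exact: codim_reflection2.
  by rewrite eqxx => /andP[].
have comb v : (v <= move_mx w)%MS -> exists p q,
    v = p *: act (g^-1)%g (alpha i) + q *: act (g^-1)%g (alpha j).
  move=> vw; have [p [q]] := sub_col_mx2 (submx_trans vw subE).
  by rewrite aE bE; exists p, q.
have gcomb p q : act g (p *: act (g^-1)%g (alpha i) +
  q *: act (g^-1)%g (alpha j)) =
    p *: alpha i + q *: alpha j by rewrite actD !actZ !actVK.
have ci p q : (p *: alpha i + q *: alpha j) 0 i = p.
  by rewrite !coordE [alpha i 0 i]mxE [alpha j 0 i]mxE !eqxx (negPf ij) mulr1
    mulr0 addr0.
have cj p q : (p *: alpha i + q *: alpha j) 0 j = q.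
  rewrite !coordE [alpha i 0 j]mxE [alpha j 0 j]mxE !eqxx eq_sym (negPf ij).
  by rewrite mulr1 mulr0 add0r.
have Qij k : B y (alpha k) = 0 -> k = i \/ k = j.
  move=> /Q4/comb[p [q]] /(congr1 (act g)); rewrite gcomb actVK => e.
  have [->|ki] := eqVneq k i; first by left.
  have [->|kj] := eqVneq k j; first by right.
  have := congr1 (fun v : V => v 0 k) e.
  rewrite !coordE [alpha k 0 k]mxE [alpha i 0 k]mxE [alpha j 0 k]mxE !eqxx.
  by rewrite (negPf ki) (negPf kj) !mulr0 addr0 => /eqP; rewrite oner_eq0.
exists g, i, j; split; [by [] | exact: Q1 | exact: Q1 | |].
  move=> r rT; rewrite mem_conjg conjgE invgK mulgA -xE //.
  apply/idP/idP => [rP|/eqP xr].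
    have stabG : group_set [set h | act h y == y].
      apply/group_setP; split; first by rewrite inE act1.
      by move=> h k; rewrite !inE => /eqP hy /eqP ky; rewrite actM ky hy.
    have : (<<[set s i; s j]>> \subset Group stabG)%g.
      rewrite gen_subG; apply/fintype.subsetP => h.
      by rewrite !inE => /orP[]/eqP ->; rewrite act_simple rfl_eq.
    move/fintype.subsetP/(_ _ rP); rewrite inE -gx !actM actK =>
      /eqP/(congr1 (act (g^-1)%g)).
    rewrite !actK act_reflection // /rfl => /eqP.
    rewrite -subr_eq0 addrAC subrr add0r oppr_eq0 scaler_eq0.
    rewrite (negPf (unit_neq0 (pos_root_norm rT))) orbF mulf_eq0 pnatr_eq0.
    by [].
  have fixy : act (g * r * g^-1)%g y = y.
    by rewrite -gx !actM actK (act_reflection _ rT) rfl_eq.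
  apply: (fintype.subsetP _ _ (dominant_stab yd fixy)).
  apply: genS; apply/fintype.subsetP => h /imsetP[k].
  by rewrite inE => /eqP/Qij[]-> ->; rewrite !inE eqxx ?orbT.
move=> r rT rw; have [p [q re]] := comb _ rw.
exists p, q; have rT' := reflection_conj g rT.
have nn := pos_root_nneg rT'; have ge := act_pos_root g rT.
have ni := Q1 _ yi; have nj := Q1 _ yj.
case: ge; rewrite re gcomb => e.
  by split=> //; [rewrite -(ci p q) e | rewrite -(cj p q) e]; exact: nn.
have p0 : 0 <= - p by rewrite -(ci p q) e coordN opprK; exact: nn.
have q0 : 0 <= - q by rewrite -(cj p q) e coordN opprK; exact: nn.
have := unit_neq0 (pos_root_norm rT); rewrite (nnvec_anti (pos_root_nneg rT))
  ?eqxx //.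
have -> : - rho r = (- p) *: act (g^-1)%g (alpha i) +
  (- q) *: act (g^-1)%g (alpha j).
  by rewrite re opprD !scaleNr.
exact: nnvec_comb.
Qed.

End RankTwoFrame.

Section DihedralReflections.
Variables a b : gT.
Hypotheses (aT : a \in T) (bT : b \in T) (ab : a != b).

Local Notation aK := (reflectionK aT).
Local Notation bK := (reflectionK bT).
Local Notation aV := (reflectionV aT).
Local Notation bV := (reflectionV bT).

(** When [x] and [y] are the two simple reflections, these are the reflections of their dihedral
    group by increasing angle of the root, from [x] at [k = 0] to [y] at [k = m - 1]. *)
Definition dih (x y : gT) k : gT := ((x * y) ^+ k * x)%g.
Local Notation D := (dih a b).
Local Notation m := #[a * b]%g.

Lemma dih_order : (1 < m)%N.
Proof.
rewrite ltn_neqAle order_gt0 andbT eq_sym order_eq1.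
apply: contra ab => /eqP e; apply/eqP/(mulIg b); by rewrite e bK.
Qed.

Lemma dih_conj k : ((a * b) * D k * (a * b)^-1)%g = D k.+2.
Proof. by rewrite /dih invMg aV bV expgS expgSr !mulgA. Qed.

Lemma dih_refl k : D k \in T.
Proof.
suff [] : D k \in T /\ D k.+1 \in T by [].
elim: k => [|k [IH1 IH2]]; last by rewrite -dih_conj reflection_conj.
rewrite /dih expg0 mul1g expg1; split=> //.
by rewrite -{2}aV reflection_conj.
Qed.

Lemma dihSM k : (D k.+1 * D k = a * b)%g.
Proof.
have -> : D k.+1 = ((a * b) * D k)%g by rewrite /dih expgS mulgA.
by rewrite -mulgA reflectionK ?mulg1 ?dih_refl.
Qed.

Lemma dih_mod k : D (k %% m) = D k.
Proof. by rewrite /dih expg_mod_order. Qed.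

Lemma dih_inj k l : (k < m)%N -> (l < m)%N -> D k = D l -> k = l.
Proof.
move=> km lm /mulIg /eqP; rewrite eq_expg_mod_order => /eqP.
by rewrite !modn_small.
Qed.

Lemma dih_last : D m.-1 = b.
Proof.
rewrite /dih; have -> : ((a * b) ^+ m.-1 = (b * a))%g.
  apply: (mulIg (a * b)%g); rewrite -expgSr prednK ?order_gt0 // expg_order.
  by rewrite mulgA -(mulgA b) aK mulg1 bK.
by rewrite -mulgA aK mulg1.
Qed.

Lemma dih_rev k : (k < m)%N -> dih b a k = D (m.-1 - k)%N.
Proof.
move=> km; apply: (mulgI ((a * b) ^+ k.+1)%g).
rewrite /dih [in RHS]mulgA -expgD (_ : (k.+1 + (m.-1 - k) = m)%N); last first.
  by have := order_gt0 (a * b)%g; lia.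
rewrite expg_order mul1g expgS -mulgA mulgA.
have -> : ((b * a) = (a * b)^-1)%g by rewrite invMg aV bV.
by rewrite !mulgA expgVn mulgK -mulgA bK mulg1.
Qed.

(** Elements of the group have the form [(a * b) ^+ k] or [(a * b) ^+ k * a], and the sign excludes
    the former. *)
Lemma dih_mem x : x \in <<[set a; b]>>%g -> x \in T ->
  exists2 k, (k < m)%N & x = D k.
Proof.
move=> xG xT; have [sg [sgM sgT]] := sign_codim.
have sg1 : sg 1%g = false by have := sgM 1%g 1%g; rewrite mulg1 addbb.
have sgX k : sg ((a * b) ^+ k)%g = false.
  by elim: k => [|k IH]; rewrite ?expg0 // expgS sgM IH sgM !sgT.
have nab : a \in 'N(<[a * b]>)%g.
  rewrite -cycle_subG norms_cycle conjgE -mulgA mulKg.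
  by have -> : (b * a = (a * b)^-1)%g; [rewrite invMg aV bV | rewrite groupV
    cycle_id].
have : x \in (<[a * b]> <*> <[a]>)%g.
  apply: (fintype.subsetP _ _ xG); rewrite gen_subG; apply/fintype.subsetP => h.
  have aG : a \in (<[a * b]> <*> <[a]>)%g by rewrite (fintype.subsetP
    (joing_subr _ _)) ?cycle_id.
  rewrite !inE => /orP[]/eqP -> //.
  have abG : (a * b)%g \in (<[a * b]> <*> <[a]>)%g.
    by rewrite (fintype.subsetP (joing_subl _ _)) ?cycle_id.
  by have := groupM (groupVr aG) abG; rewrite mulKg.
rewrite norm_joinEr ?cycle_subG // => /mulsgP[y z /cycleP[k ->] /cycleP[e ->]
  xE].
have [ae|ae] : (a ^+ e = 1 \/ a ^+ e = a)%g.
- by elim: (e) => [|i [IH|IH]]; rewrite ?expg0 ?expgS ?IH ?aK ?mulg1;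
  [left|right|left].
- by move: (sgT _ xT); rewrite xE ae mulg1 sgX.
exists (k %% m)%N; first by rewrite ltn_mod order_gt0.
by rewrite dih_mod xE ae.
Qed.

Definition dih_angle : R := pi / m%:R.
Local Notation th := dih_angle.
Hypothesis Bab : B (rho a) (rho b) = - cos th.

Local Notation na := (pos_root_norm aT).
Local Notation nb := (pos_root_norm bT).

Lemma dih_angle_pi : m%:R * th = pi.
Proof. by rewrite mulrC divfK // pnatr_eq0 -lt0n order_gt0. Qed.

Lemma dih_angle_gt0 : 0 < th.
Proof. by rewrite divr_gt0 ?pi_gt0 // ltr0n order_gt0. Qed.

Lemma dih_angle_le : th <= pi / 2.
Proof.
rewrite ler_pM2l ?pi_gt0 // lef_pV2 ?posrE ?ltr0n ?order_gt0 //.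
by rewrite ler_nat dih_order.
Qed.

Lemma sin_dih_angle : 0 < sin th.
Proof.
apply: sin_gt0_pi; rewrite dih_angle_gt0 /=.
by apply: (le_lt_trans dih_angle_le); have := pi_gt0 R; lra.
Qed.

Lemma cos_dih_angle : 0 <= cos th.
Proof.
apply: cos_ge0_pihalf; rewrite dih_angle_le andbT.
by apply: (le_trans _ (ltW dih_angle_gt0)); have := pi_gt0 R; lra.
Qed.

(** The unit vector at angle [k * th] from the root of [a], in the plane of both roots. *)
Definition dih_root k : V :=
  (sin th)^-1 *: dihedral_vec (rho a) (rho b) th (k%:R * th).

Lemma sin_th_neq0 : sin th != 0. Proof. by rewrite gt_eqF // sin_dih_angle. Qed.

Lemma dih_root0 : dih_root 0 = rho a.
Proof.
by rewrite /dih_root /dihedral_vec mul0r add0r sin0 scale0r addr0 scalerA mulVf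
  ?scale1r ?sin_th_neq0.
Qed.

Lemma dih_root1 : dih_root 1 = act a (rho b).
Proof.
rewrite act_reflection // /rfl (BC (rho b)) Bab /dih_root /dihedral_vec mul1r.
have -> : sin (th + th) = 2 * cos th * sin th by rewrite sinD; ring.
rewrite scalerDr !scalerA mulVf ?sin_th_neq0 // scale1r addrC.
congr (_ + _); rewrite mulrN scaleNr opprK; congr (_ *: _).
by rewrite mulrC mulfK ?sin_th_neq0.
Qed.

Lemma dih_rootSS k : act (a * b)%g (dih_root k) = dih_root k.+2.
Proof.
rewrite actM /dih_root !actZ (act_reflection _ bT) (act_reflection _ aT);
  congr (_ *: _).
rewrite (rfl_dihedral_vec (order_simple hW) na nb Bab); congr dihedral_vec.
by rewrite -[k.+2]addn2 natrD; ring.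
Qed.

Lemma dih_root_act k : (forall x, act (D k) x = rfl (dih_root k) x) /\
  B (dih_root k) (dih_root k) = 1.
Proof.
suff [] : ((forall x, act (D k) x = rfl (dih_root k) x) /\
    B (dih_root k) (dih_root k) = 1) /\
    ((forall x, act (D k.+1) x = rfl (dih_root k.+1) x) /\
    B (dih_root k.+1) (dih_root k.+1) = 1) by [].
elim: k => [|k [IH1 IH2]].
  rewrite dih_root0 dih_root1 act_isom na nb /dih expg0 mul1g expg1;
    do 2![split=> //] => x.
    by rewrite act_reflection.
  by rewrite -{2}aV !actM (act_reflection _ bT) act_rfl actVK.
split=> //; rewrite -dih_rootSS act_isom -dih_conj; split=> [x|];
  last by case: IH1.
by rewrite !(actM (_ * _)%g) IH1.1 act_rfl actVK.
Qed.

Lemma dih_root_adj k : B (dih_root k.+1) (dih_root k) = cos th.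
Proof.
suff [] : B (dih_root k.+1) (dih_root k) = cos th /\
  B (dih_root k.+2) (dih_root k.+1) = cos th by [].
elim: k => [|k [IH1 IH2]]; last first.
  by split=> //; rewrite -(dih_rootSS k.+1) -(dih_rootSS k) act_isom.
rewrite -dih_rootSS dih_root0 dih_root1 actM act_isom.
have ea : act a (rho a) = - rho a by rewrite act_reflection // rfl_id ?na.
have eb : act b (rho b) = - rho b by rewrite act_reflection // rfl_id ?nb.
split.
  by rewrite -[X in B _ X]opprK -ea root_formNr act_isom (BC (rho b)) Bab opprK.
by rewrite -[X in B _ X]opprK -eb root_formNr act_isom Bab opprK.
Qed.

(** For [k < m] the angles [k * th] and [(k + 1) * th] are at most [pi], so the vector is a
    nonnegative combination of two positive roots. *)
Lemma pos_root_dih k : (k < m)%N -> rho (D k) = dih_root k.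
Proof.
move=> km; have [kact knorm] := dih_root_act k.
apply: pos_root_uniq => //; first exact: dih_refl.
have sn (l : nat) : (l <= m)%N -> 0 <= (sin th)^-1 * sin (l%:R * th).
  move=> lm; rewrite mulr_ge0 // ?invr_ge0 ?(ltW sin_dih_angle) //;
    apply: sin_ge0_pi.
  rewrite mulr_ge0 ?(ltW dih_angle_gt0) //= -dih_angle_pi ler_wpM2r ?ler_nat //.
  exact: ltW dih_angle_gt0.
rewrite /dih_root /dihedral_vec scalerDr !scalerA.
have -> : k%:R * th + th = k.+1%:R * th by rewrite -[k.+1]addn1 natrD; ring.
by apply: nnvec_comb; rewrite ?sn ?(ltnW km) //; exact: pos_root_nneg.
Qed.

Lemma dih_desc k : (k.+1 < m)%N -> 0 <= B (rho (D k.+1)) (rho (D k)).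
Proof.
move=> km; rewrite !pos_root_dih ?(ltnW km) //.
by rewrite dih_root_adj cos_dih_angle.
Qed.

Lemma dih_comm : B (rho a) (rho b) = 0 -> (a * b = b * a)%g.
Proof.
move=> h; apply: (mulIg (b * a)^-1%g); rewrite mulgV; apply: act_faithful => x.
rewrite invMg aV bV !actM (act_reflection x bT) (act_reflection _ aT)
  (act_reflection _ bT).
rewrite (act_reflection _ aT).
have e z : rfl (rho a) (rfl (rho b) z) = rfl (rho b) (rfl (rho a) z).
  rewrite /rfl !root_formE (BC (rho b)) h !mulr0 !subr0.
  by apply/rowP => j; rewrite !coordE; ring.
by rewrite (e x) (rflK nb) (rflK na).
Qed.

(** The component [z] of the root of [b] orthogonal to that of [a] has positive product with every
    other positive root of [P]; a nonnegative combination of these equal to the root of [a] would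
    have only zero coefficients. *)
Lemma parabolic_simple_dih (P : {set gT}) : a \in P -> 
  (forall r : gT, r \in T -> r \in P ->
     exists p q : R, [/\ 0 <= p, 0 <= q & rho r = p *: rho a + q *: rho b]) ->
  parabolic_simple s R P a.
Proof.
move=> aP hP; split; first by rewrite inE aT aP.
case=> co [co0 e].
pose z := rho b - B (rho b) (rho a) *: rho a.
have za : B z (rho a) = 0 by rewrite /z !root_formE na; ring.
have zb : 0 < B z (rho b).
  rewrite /z !root_formE nb (BC (rho b)) Bab.
  have -> : 1 + - (- cos th * - cos th) = sin th ^+ 2 by rewrite sin2cos2; ring.
  by rewrite exprn_gt0 // sin_dih_angle.
have zr (r : gT) : r \in (T :&: P) :\ a -> 0 < B z (rho r).
  rewrite !inE => /and3P[ra rT rP]; have [p [q [p0 q0 re]]] := hP r rT rP.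
  rewrite re root_formDr !root_formZr za mulr0 add0r pmulr_rgt0 // lt_def q0
    andbT.
  apply: contra ra => /eqP q00; move: re; rewrite q00 scale0r addr0 => re.
  apply/eqP/pos_root_inj => //; rewrite re.
  have := pos_root_norm rT; rewrite re !root_formE na mulr1 -expr2 => /eqP.
  by rewrite sqrp_eq1 // => /eqP ->; rewrite scale1r.
have := congr1 (B z) e; rewrite za root_form_sumr => /esym e0.
have ge0 (r : gT) : r \in (T :&: P) :\ a -> 0 <= B z (co r *: rho r).
  by move=> rP; rewrite root_formZr mulr_ge0 // ltW // zr.
have co00 (r : gT) : r \in (T :&: P) :\ a -> co r = 0.
  move=> rP; have /eqP := psumr_eq0P ge0 e0 rP.
  by rewrite root_formZr mulf_eq0 (gt_eqF (zr _ rP)) orbF => /eqP.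
have := unit_neq0 na; rewrite e big1 ?eqxx // => r rP.
by rewrite co00 // scale0r.
Qed.

End DihedralReflections.

Implicit Types a b : refl s.

Definition mkrefl (t : gT) (tT : t \in T) : refl s := exist (fun x : gT =>
  x \in T) t tT.

(** * The compatible ordering in rank two *)

Variable prec : rel (refl s).
Hypotheses (hprec : reflection_ordering R prec) (hcomp : c_compatible c prec).

Lemma prec_irr : irreflexive prec. Proof. by case: hprec. Qed.
Lemma prec_trans : transitive prec. Proof. by case: hprec. Qed.
Lemma prec_total t u : t != u -> prec t u || prec u t.
Proof. by case: hprec => _ _ h _; exact: h. Qed.
Lemma prec_asym t u : prec t u -> ~~ prec u t.
Proof. by move=> tu; apply/negP => /(prec_trans tu); rewrite prec_irr. Qed.

Definition dihr (a b : refl s) k : refl s := insubd a (dih (val a) (val b) k).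

Lemma val_dihr a b k : val (dihr a b k) = dih (val a) (val b) k.
Proof. by rewrite insubdK // dih_refl // reflT. Qed.

Definition dihs (a b : refl s) := mkseq (dihr a b) #[val a * val b]%g.

Lemma size_dihs a b : size (dihs a b) = #[val a * val b]%g.
Proof. exact: size_mkseq. Qed.

Lemma mem_dihs a b (r : refl s) : r \in dihs a b ->
  exists2 k, (k < #[val a * val b]%g)%N & r = dihr a b k.
Proof. by case/mapP => k; rewrite mem_iota add0n => km ->; exists k. Qed.

Lemma cyc_nth_dihs a b i : cyc_nth (dihs a b) i = dih (val a) (val b) i.
Proof.
rewrite /cyc_nth size_dihs -map_comp (nth_map 0%N) ?size_iota ?ltn_mod
  ?order_gt0 //=.
by rewrite nth_iota ?ltn_mod ?order_gt0 // add0n val_dihr /dih expg_mod_order.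
Qed.

Lemma order_refC a b : #[val a * val b]%g = #[val b * val a]%g.
Proof. by rewrite -orderV invMg !reflV. Qed.

Lemma dihs_rev a b : val a != val b -> dihs b a = rev (dihs a b).
Proof.
move=> ab; apply: (@eq_from_nth _ a); first by rewrite size_rev !size_dihs
  order_refC.
rewrite size_dihs order_refC => i im.
rewrite nth_rev ?size_dihs // !nth_mkseq; last 2 first.
- by have := order_gt0 (val a * val b)%g; lia.
- by rewrite order_refC.
apply: val_inj; rewrite !val_dihr dih_rev ?reflT //; congr dih.
by rewrite -subn1 -subnDA add1n.
Qed.

(** [a] and [b] are the simple reflections of the parabolic subgroup attached to [w], as the angle
    between their roots expresses. *)
Definition frame w (a b : refl s) := [/\ val a != val b,
  B (rt a) (rt b) = - cos (dih_angle (val a) (val b)) &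
  forall r : refl s, abs_le s (val r) w = (r \in dihs a b)].

Lemma frame_sym w a b : frame w a b -> frame w b a.
Proof.
case=> ab Bab h; split; first by rewrite eq_sym.
  by rewrite BC Bab /dih_angle order_refC.
by move=> r; rewrite h (dihs_rev ab) mem_rev.
Qed.

Lemma ncw_neq t u : ncw [:: t; u] -> val t != val u.
Proof.
move=> /ncw_pair h; apply/eqP => e.
by have := chi_root_neq0 (rt_norm t); rewrite {2}e h eqxx.
Qed.

(** Of the two orders allowed to a reflection ordering, the reversed one lists the reflections of
    the pair [b], [a]: exchanging the two simple reflections if needed makes the list increasing. *)
Lemma rank2_sorted t u : ncw [:: t; u] ->
  exists a b, frame (val t * val u)%g a b /\ sorted prec (dihs a b).
Proof.
move=> ntu; have tu := ncw_neq ntu; set w := (val t * val u)%g.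
have w2 : exists t u : gT, [/\ t \in T, u \in T, t != u & w = (t * u)%g].
  by exists (val t), (val u); rewrite !reflT.
have [g [i [j [ij ni nj hP hpos]]]] := rank2_frame w2.
have iT := reflection_conj (g^-1)%g (simple_reflection i).
have jT := reflection_conj (g^-1)%g (simple_reflection j).
pose a := mkrefl iT; pose b := mkrefl jT.
have aE : rt a = act (g^-1)%g (alpha i).
  by rewrite pos_root_conj ?simple_reflection // pos_root_simple.
have bE : rt b = act (g^-1)%g (alpha j).
  by rewrite pos_root_conj ?simple_reflection // pos_root_simple.
have vi : val a = (s i ^ g)%g by rewrite /= invgK conjgE mulgA.
have vj : val b = (s j ^ g)%g by rewrite /= invgK conjgE mulgA.
have ord : #[val a * val b]%g = #[s i * s j]%g by rewrite vi vj -conjMg orderJ.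
have ab : val a != val b.
  by rewrite vi vj (inj_eq (conjg_inj g)) (inj_eq (simple_inj hW)).
have Bab : B (rt a) (rt b) = - cos (dih_angle (val a) (val b)).
  by rewrite aE bE act_isom simple_root_form_angle /dih_angle ord.
set P := (<<[set s i; s j]>> :^ g)%g in hP.
have PE : P = <<[set val a; val b]>>%g.
  by rewrite /P -genJ conjUg !conjg_set1 -vi -vj.
have aP : val a \in P by rewrite PE mem_gen // !inE eqxx.
have bP : val b \in P by rewrite PE mem_gen // !inE eqxx orbT.
have memP (r : refl s) : (r \in dihs a b) = (val r \in P).
  apply/idP/idP => [/mem_dihs[k _ ->]|rP].
    have aG : val a \in <<[set val a; val b]>>%g by rewrite -PE.
    have bG : val b \in <<[set val a; val b]>>%g by rewrite -PE.
    by rewrite val_dihr PE /dih groupM // groupX // groupM.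
  rewrite PE in rP; have [k km re] := dih_mem (reflT a) (reflT b) rP (reflT r).
  apply/mapP; exists k; first by rewrite mem_iota.
  by apply: val_inj; rewrite val_dihr.
have fr : frame w a b by split=> // r; rewrite abs_le_root ?reflT // -hP ?reflT.
have uq : uniq (dihs a b).
  apply/mkseq_uniqP => k l km lm /(congr1 val); rewrite !val_dihr.
  exact: dih_inj.
have posP (r : gT) : r \in T -> r \in P ->
    exists p q : R, [/\ 0 <= p, 0 <= q & rho r = p *: rt a + q *: rt b].
  by move=> rT rP; rewrite aE bE; apply: hpos; rewrite // -hP.
have [_ _ _ hord] := hprec.
have [||||||so|so] := hord P (dihs a b).
- by exists i, j, g.
- exact: uq.
- exact: memP.
- by move=> k; rewrite !cyc_nth_dihs !dihSM ?reflT.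
- rewrite cyc_nth_dihs /dih expg0 mul1g.
  by apply: (parabolic_simple_dih (reflT a) (reflT b)).
- rewrite cyc_nth_dihs size_dihs dih_last ?reflT //.
  apply: (parabolic_simple_dih (reflT b) (reflT a));
    rewrite ?[_ == val a]eq_sym //.
    by rewrite BC Bab /dih_angle order_refC.
  move=> r rT rP; have [p [q [p0 q0 ->]]] := posP r rT rP.
  by exists q, p; split=> //; exact: addrC.
- by exists a, b.
- by exists b, a; rewrite (dihs_rev ab); split=> //; exact: frame_sym.
Qed.

(** Compatibility at index 0 says that [w] is the second reflection of the list times the first,
    which is [a * b] and not [b * a]. *)
Lemma rank2_prod t u a b : ncw [:: t; u] -> frame (val t * val u)%g a b ->
  sorted prec (dihs a b) -> (val t * val u = val a * val b)%g.
Proof.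
move=> ntu [ab Bab h] so.
have wNC : (val t * val u)%g \in NC_rank s c 2.
  by move: ntu; rewrite ncwP big_cons big_seq1 !inE.
rewrite (hcomp wNC so _ 0) => [|r]; last by rewrite h.
by rewrite !cyc_nth_dihs dihSM ?reflT.
Qed.

Lemma dihs_prec a b k l : sorted prec (dihs a b) -> (k < l)%N ->
  (l < #[val a * val b]%g)%N -> prec (dihr a b k) (dihr a b l).
Proof.
move=> so kl lm; have km := ltn_trans kl lm.
have := sorted_ltn_nth prec_trans a so; move/(_ k l).
by rewrite !inE !size_dihs !nth_mkseq // => /(_ km lm kl).
Qed.

(** [t] is some [dihr a b k] and determines [u]. For [k = 0] its partner wraps around to the last
    reflection, which is [b]; otherwise it is the preceding one. *)
Lemma rank2_index t u a b : val t != val u -> frame (val t * val u)%g a b ->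
  (val t * val u = val a * val b)%g ->
  (t = a /\ u = b) \/ exists2 k, (k.+1 < #[val a * val b]%g)%N &
    t = dihr a b k.+1 /\ u = dihr a b k.
Proof.
move=> tu [ab Bab h] e.
have : t \in dihs a b.
  by rewrite -h abs_le_root ?reflT // move_mx2 ?reflT // -addsmxE addsmxSl.
case/mem_dihs => -[|k] km te; [left|right].
  have ta : t = a by apply: val_inj; rewrite te val_dihr /dih expg0 mul1g.
  by split=> //; apply: val_inj; move: e; rewrite ta => /mulgI.
exists k => //; split=> //; apply: val_inj.
apply: (mulgI (val t)); rewrite e te !val_dihr.
by rewrite dihSM ?reflT.
Qed.

Lemma rank2_desc t u : ncw [:: t; u] -> prec u t -> 0 <= B (rt t) (rt u).
Proof.
move=> ntu ut; have [a [b [fr so]]] := rank2_sorted ntu.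
have e := rank2_prod ntu fr so; have tu := ncw_neq ntu.
have [ab Bab _] := fr.
have [[ta ub]|[k km [-> ->]]] := rank2_index tu fr e; last first.
  by rewrite !val_dihr dih_desc ?reflT.
move/negP: (prec_asym ut); case; rewrite ta ub.
have m1 := dih_order (reflT b) ab.
have -> : b = dihr a b #[val a * val b]%g.-1.
  by apply: val_inj; rewrite val_dihr dih_last ?reflT.
have {1}-> : a = dihr a b 0 by apply: val_inj;
  rewrite val_dihr /dih expg0 mul1g.
by apply: dihs_prec; rewrite // ?ltn_predRL ?ltn_predL // order_gt0.
Qed.

(** The increasing factorization is the pair of simple reflections. By the last clause any other one
    starts with a larger letter, so that replacing an ascent increases a word lexicographically. *)
Lemma rank2_asc t u : ncw [:: t; u] -> prec t u -> [/\ B (rt t) (rt u) <= 0,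
  B (rt t) (rt u) = 0 -> (val t * val u = val u * val t)%g &
  forall t' u', (val t' * val u' = val t * val u)%g -> t' != t ->
    prec u' t' /\ prec t t'].
Proof.
move=> ntu ltu; have [a [b [fr so]]] := rank2_sorted ntu.
have e := rank2_prod ntu fr so; have tu := ncw_neq ntu.
have [ab Bab _] := fr.
have [[ta ub]|[k km [te ue]]] := rank2_index tu fr e; last first.
  by move/negP: (prec_asym ltu); case; rewrite te ue dihs_prec.
subst t u; split.
- by rewrite Bab oppr_le0 cos_dih_angle ?reflT.
- exact: (dih_comm (reflT a) (reflT b)).
move=> t' u' e' t'a.
have tu' : val t' != val u'.
  apply: contra ab => /eqP h; move: e'; rewrite h reflK => /esym e1.
  by apply/eqP; apply: (mulIg (val b)); rewrite e1 reflK.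
have fr' : frame (val t' * val u')%g a b by rewrite e'.
have [[ta _]|[k km [te ue]]] := rank2_index tu' fr' e';
  first by rewrite ta eqxx in t'a.
rewrite te ue; split; first exact: dihs_prec.
have {1}-> : a = dihr a b 0 by apply: val_inj;
  rewrite val_dihr /dih expg0 mul1g.
exact: dihs_prec.
Qed.

(** * Decreasing words and faces *)

Definition pgt : rel (refl s) := fun t u => prec u t.

Lemma pgt_trans : transitive pgt.
Proof. by move=> u t v /= ut vu; exact: prec_trans vu ut. Qed.

Definition prec_rank t := #|[set u | prec u t]|.

Lemma prec_rank_lt t u : prec t u -> (prec_rank t < prec_rank u)%N.
Proof.
move=> tu; apply: proper_card; apply/properP; split.
  by apply/fintype.subsetP => v; rewrite !inE => vt; exact: prec_trans vt tu.
by exists t; rewrite !inE ?prec_irr.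
Qed.

Lemma prec_rank_bound t : (prec_rank t < #|refl s|)%N.
Proof.
rewrite -cardsT; apply: proper_card; apply/properP; split.
  exact: finset.subsetT.
by exists t; rewrite !inE ?prec_irr.
Qed.

(* Compares words of the same length lexicographically. *)
Fixpoint lex_code r : nat :=
  if r is t :: r' then (prec_rank t * #|refl s| ^ size r' +
    lex_code r')%N else 0%N.

Lemma lex_code_bound r : (lex_code r < #|refl s| ^ size r)%N.
Proof.
elim: r => [|t r IH] //=.
apply: (@leq_trans (prec_rank t * #|refl s| ^ size r + #|refl s| ^ size r)%N).
  by rewrite ltn_add2l.
by rewrite addnC -mulSn expnS leq_mul2r prec_rank_bound orbT.
Qed.

Lemma lex_code_lt r1 t r t' r' : size r = size r' ->
  (prec_rank t < prec_rank t')%N ->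
  (lex_code (r1 ++ t :: r) < lex_code (r1 ++ t' :: r'))%N.
Proof.
move=> sz tt; elim: r1 => [|u r1 IH] /=; last first.
  by rewrite !size_cat /= sz ltn_add2l.
rewrite sz; apply: (@leq_trans ((prec_rank t).+1 * #|refl s| ^ size r')%N).
  by rewrite mulSn addnC ltn_add2r -sz lex_code_bound.
apply: leq_trans (leq_addr _ _).
by rewrite leq_mul2r tt orbT.
Qed.

(** Termination measure of the inductions that increase [lex_code] under its bound [N]. *)
Lemma ltn_sub_step (N a b d : nat) :
  (N - a < d.+1 -> a < b -> b < N -> N - b < d)%N.
Proof. lia. Qed.

Lemma not_sorted_adj (e : rel (refl s)) r : ~~ sorted e r ->
  exists r1 p q r2, r = r1 ++ p :: q :: r2 /\ ~~ e p q.
Proof.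
case: r => // p r; elim: r p => //= q r IH p.
rewrite negb_and => /orP[npq|/IH[r1 [p' [q' [r2 [re ne]]]]]].
  by exists [::], p, q, r.
by exists (p :: r1), p', q', r2; rewrite re.
Qed.

Lemma ncw_adj r1 p q r2 : ncw (r1 ++ p :: q :: r2) -> ncw [:: p; q].
Proof.
apply: ncw_subseq.
apply: (@subseq_trans _ ([:: p; q] ++ r2)); first exact: prefix_subseq.
exact: suffix_subseq.
Qed.

Lemma ncw_ascent r : ncw r -> ~~ sorted pgt r ->
  exists r1 p q r2, [/\ r = r1 ++ p :: q :: r2, ncw [:: p; q] & prec p q].
Proof.
move=> nr /not_sorted_adj[r1 [p [q [r2 [re npq]]]]].
exists r1, p, q, r2; rewrite re in nr; have npq' := ncw_adj nr; split=> //.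
have /prec_total : p != q by apply: contra (ncw_neq npq') => /eqP ->.
by rewrite /pgt in npq; rewrite (negPf npq) orbF.
Qed.

Lemma ncw_eq r r' : wp r = wp r' -> size r = size r' -> ncw r = ncw r'.
Proof. by rewrite /ncw => -> ->. Qed.

Lemma wp_swap r1 p q p' q' r2 : (val p * val q = val p' * val q')%g ->
  wp (r1 ++ p :: q :: r2) = wp (r1 ++ p' :: q' :: r2).
Proof. by move=> e; rewrite !big_cat !big_cons /= !(mulgA (val _)) e. Qed.

Lemma subseq_split r (r1 r2 : seq (refl s)) : subseq r (r1 ++ r2) ->
  exists s1 s2, [/\ r = s1 ++ s2, subseq s1 r1 & subseq s2 r2].
Proof.
elim: r1 r => [|t r1 IH] r /=; first by exists [::], r; rewrite ?sub0seq.
case: r => [|u r]; first by exists [::], [::]; rewrite !sub0seq.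
case: eqP => [->|_] /IH[s1 [s2 [re h1 h2]]].
  by exists (t :: s1), s2; rewrite re /= eqxx.
exists s1, s2; split=> //; exact: subseq_trans h1 (subseq_cons _ _).
Qed.

Lemma refl_conj t u : exists v : refl s, val v = (val t * val u * val t)%g.
Proof.
have h := reflection_conj (val t) (reflT u).
by exists (mkrefl h); rewrite /= reflV.
Qed.

(* Among the words for [c] of which [r] is a subword, the lexicographically
   largest is decreasing: an ascent can be improved while keeping either of its
   letters. *)
Lemma desc_extend r r' : sorted pgt r -> ncw r' -> subseq r r' ->
  exists r'', [/\ ncw r'', size r'' = size r', subseq r r'' & sorted pgt r''].
Proof.
move=> sr; have [d] := ubnP (#|refl s| ^ size r' - lex_code r')%N.
elim: d r' => // d IH r' led nr' rr'.
have [so|/(ncw_ascent nr')[r1 [p [q [r2 [re npq lpq]]]]]] :=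
  boolP (sorted pgt r').
  by exists r'.
have [_ _ better] := rank2_asc npq lpq.
have step p' q' : (val p' * val q' = val p * val q)%g -> p' != p ->
    subseq r (r1 ++ p' :: q' :: r2) ->
    exists r'', [/\ ncw r'', size r'' = size r', subseq r r'' & sorted pgt r''].
  move=> e p'p sub; have [_ lt] := better _ _ e p'p.
  have sz' : size (r1 ++ p' :: q' :: r2) = size r' by rewrite re !size_cat.
  rewrite -sz'; apply: IH => //.
    apply: ltn_sub_step (lex_code_bound _); first by rewrite sz'; exact: led.
    by rewrite re; apply: lex_code_lt => //; exact: prec_rank_lt.
  rewrite (@ncw_eq _ r') // re; exact: wp_swap.
(* The product [p q] equals both [v p] and [q x]: one factorization keeps [p], the other keeps
   [q]. *)
have [v vE] := refl_conj p q; have [x xE] := refl_conj q p.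
have vp : v != p.
  apply: contra (ncw_neq npq) => /eqP h; move: vE; rewrite h => /esym e.
  apply/eqP; apply: (mulgI (val p)); apply: (mulIg (val p)).
  by rewrite e reflK mul1g.
have qp : q != p by apply: contra (ncw_neq npq) => /eqP ->.
rewrite re in rr'; have [s1 [s2 [rs sub1 sub2]]] := subseq_split rr'.
have [s3 [s4 [rs2 sub3 sub4]]] := @subseq_split s2 [:: p; q] r2 sub2.
have build m : subseq s3 m -> subseq r (r1 ++ m ++ r2).
  by move=> h; rewrite rs rs2 !cat_subseq.
have [h|np] := boolP (subseq s3 [:: p]).
  apply: (step v p); rewrite ?vE -?mulgA ?reflK ?mulg1 //.
  exact: build [:: v; p] (subseq_trans h (subseq_cons _ _)).
have [h|nq] := boolP (subseq s3 [:: q]).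
  apply: (step q x); rewrite ?xE ?mulgA ?reflK ?mul1g //.
  exact: build [:: q; x] (subseq_trans h (prefix_subseq _ _)).
(* In the remaining case [r] uses both letters of the ascent, which is impossible as [r] is
   decreasing. *)
have s3E : s3 = [:: p; q].
  case: s3 sub3 np nq {rs2 build} => [|y [|z s3]] //=.
    by do 2!case: eqP.
  case: eqP => [->|_]; last by case: eqP.
  by case: (z =P q) => [-> /eqP ->|//].
move: sr; rewrite rs rs2 s3E => /(cat_sorted2 (s := s1))[_] /=.
by rewrite {1}/pgt => /andP[qp' _]; have := prec_asym lpq; rewrite qp'.
Qed.

Lemma Tpow_word m (w : gT) : (w \in T ^+ m)%g ->
  exists2 r : seq (refl s), size r = m & wp r = w.
Proof.
elim: m w => [|m IH] w; first by rewrite expg0 => /set1P ->; exists [::];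
  rewrite ?big_nil.
rewrite expgS => /mulsgP[t u tT /IH[r rm ru] ->].
by exists (mkrefl tT :: r); rewrite /= ?rm // big_cons ru.
Qed.

Lemma desc_facet r : ncw r -> sorted pgt r ->
  exists r', [/\ ncw r', size r' = n, subseq r r' & sorted pgt r'].
Proof.
move=> nr sr; have [r2 sz2 w2] := Tpow_word (mem_Tpow_codim ((wp r)^-1 * c)%g).
have sz : size (r ++ r2) = n by rewrite size_cat sz2 addnC; exact/eqP.
have full : ncw (r ++ r2).
  have := ncw_full (r ++ r2); rewrite sz eqxx !andbT => <-.
  by rewrite big_cat /= w2 mulKVg.
have [r' [h1 h2 h3 h4]] := desc_extend sr full (prefix_subseq _ _).
by exists r'; rewrite h2.
Qed.

(* Bubble sort: an ascent with nonnegative scalar product commutes. *)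
Lemma pos_sort r : ncw r ->
  (forall t u, t \in r -> u \in r -> t != u -> 0 <= B (rt t) (rt u)) ->
  exists r', [/\ perm_eq r' r, wp r' = wp r & sorted pgt r'].
Proof.
have [d] := ubnP (#|refl s| ^ size r - lex_code r)%N.
elim: d r => // d IH r led nr pos.
have [so|/(ncw_ascent nr)[r1 [p [q [r2 [re npq lpq]]]]]] :=
  boolP (sorted pgt r).
  by exists r.
have [le0 comm _] := rank2_asc npq lpq.
have pq : p != q by apply: contra (ncw_neq npq) => /eqP ->.
have e : (val p * val q = val q * val p)%g.
  apply: comm; apply: le_anti; rewrite le0 /=; apply: pos => //.
    by rewrite re mem_cat mem_head orbT.
  by rewrite re mem_cat !inE eqxx !orbT.
have pe : perm_eq (r1 ++ q :: p :: r2) r.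
  by rewrite re perm_cat2l -[q :: _]/([:: q] ++ [:: p] ++ r2) perm_catCA.
have we : wp (r1 ++ q :: p :: r2) = wp r by rewrite re; exact: wp_swap.
have [|||r' [h1 h2 h3]] := IH (r1 ++ q :: p :: r2).
- apply: ltn_sub_step (lex_code_bound _); first by rewrite (perm_size pe);
  exact: led.
  by rewrite re; apply: lex_code_lt => //; exact: prec_rank_lt.
- by rewrite (ncw_eq we (perm_size pe)).
- by move=> t u; rewrite !(perm_mem pe); exact: pos.
by exists r'; rewrite h2 we; split=> //; exact: perm_trans h1 pe.
Qed.

Lemma desc_pos r : ncw r -> sorted pgt r ->
  forall t u, t \in r -> u \in r -> t != u -> 0 <= B (rt t) (rt u).
Proof.
elim: r => // t r IH nr sr.
have sr' : sorted pgt r by exact: path_sorted sr.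
have nr' : ncw r by apply: ncw_subseq nr; exact: subseq_cons.
have al := order_path_min pgt_trans sr.
have key u : u \in r -> 0 <= B (rt t) (rt u).
  move=> ur; apply: rank2_desc; last exact: (allP al).
  by apply: ncw_subseq nr; rewrite /= eqxx sub1seq.
move=> u v; rewrite !inE => /orP[/eqP->|ur] /orP[/eqP->|vr];
  rewrite ?eqxx // => uv.
- exact: key.
- by rewrite BC key.
- exact: IH.
Qed.

(** The order by which [xface] sorts a face: [xface] is the product along [fword]. *)
Definition fleq : rel (refl s) := fun t u => (t == u) || prec u t.

Lemma fleq_total : total fleq.
Proof.
move=> t u; rewrite /fleq (eq_sym u t); case: eqVneq => //= tu.
by rewrite orbC; exact: prec_total.
Qed.
Lemma fleq_trans : transitive fleq.
Proof.
move=> u t v /orP[/eqP->//|ut] /orP[/eqP<-|vu]; apply/orP; right=> //.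
exact: prec_trans vu ut.
Qed.
Lemma fleq_anti : antisymmetric fleq.
Proof.
move=> t u /andP[/orP[/eqP->//|ut] /orP[/eqP->//|tu]].
by have := prec_asym ut; rewrite tu.
Qed.

Lemma sorted_pgt_uniq r : sorted pgt r -> uniq r.
Proof. by apply: sorted_uniq; [exact: pgt_trans | exact: prec_irr]. Qed.

Definition fword (f : {set refl s}) := sort fleq (enum f).

Lemma fwordE r : sorted pgt r -> fword [set t in r] = r.
Proof.
move=> sr; apply: (sorted_eq fleq_trans fleq_anti).
- exact: sort_sorted fleq_total _.
- by apply: sub_sorted sr => t u; rewrite /fleq /pgt => ->; exact: orbT.
rewrite perm_sort; apply: uniq_perm; rewrite ?enum_uniq ?sorted_pgt_uniq //.
by move=> t; rewrite mem_enum inE.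
Qed.

Lemma fword_set (f : {set refl s}) : f = [set t in fword f].
Proof. by apply/setP => t; rewrite inE mem_sort mem_enum. Qed.

Lemma size_fword (f : {set refl s}) : size (fword f) = #|f|.
Proof. by rewrite size_sort -cardE. Qed.

Lemma fword_sorted (f : {set refl s}) : sorted pgt (fword f).
Proof.
have := sort_sorted fleq_total (enum f); have :
  uniq (fword f) by rewrite sort_uniq enum_uniq.
rewrite -/(fword f); elim: (fword f) => [|t [|u r] IH] //= /and3P[tr ur uq]
  /andP[tu p].
apply/andP; split; last by apply: IH; rewrite /= ?ur.
by move: tu tr; rewrite /fleq inE negb_or; case: eqP.
Qed.

(** By [pos_sort] the letters of the facet can be put in decreasing order without changing their
    product [c]. *)
Lemma pos_facet_desc (F : {set refl s}) :
  is_pos_facet R c F -> ncw (fword F) && (size (fword F) == n).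
Proof.
case/existsP => r /and3P[/eqP FE /eqP cE /forallP pos].
have nr : ncw r.
  have := ncw_full r; rewrite size_tuple eqxx !andbT => <-.
  by rewrite -cE.
have [|r' [pe we so]] := pos_sort nr.
- move=> t u /tnthP[i ->] /tnthP[j ->] tu.
  have /forallP/(_ j)/implyP := pos i; apply.
  by apply: contra tu => /eqP ->.
have -> : fword F = r'.
  rewrite FE -(fwordE so); congr fword; apply/setP => t.
  by rewrite !inE (perm_mem pe).
by rewrite (ncw_eq we (perm_size pe)) nr (perm_size pe) size_tuple eqxx.
Qed.

(** The word of a face is a subword of the decreasing word of a facet. Conversely [desc_facet]
    completes a decreasing word to one for [c], and [desc_pos] gives the condition on angles. *)
Lemma face_desc (f : {set refl s}) :
  (f \in pos_cluster_complex s R c) = ncw (fword f).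
Proof.
apply/idP/idP.
  rewrite inE => /existsP[F /andP[/pos_facet_desc/andP[nF _] fF]].
  have -> : fword f = [seq t <- fword F | t \in f].
    apply: (sorted_eq fleq_trans fleq_anti).
    - exact: sort_sorted fleq_total _.
    - by apply: sorted_filter; [exact: fleq_trans | exact: sort_sorted
      fleq_total _].
    apply: uniq_perm; rewrite ?filter_uniq ?sort_uniq ?enum_uniq // => t.
    rewrite mem_filter !mem_sort !mem_enum.
    by case: (boolP (t \in f)) => // /(fintype.subsetP fF).
  by apply: ncw_subseq nF; exact: filter_subseq.
move=> nf; have [r' [nr sz sub so]] := desc_facet nf (fword_sorted f).
rewrite inE; apply/existsP; exists [set t in r']; apply/andP; split; last first.
  by apply/fintype.subsetP => t; rewrite {1}[f]fword_set !inE;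
    exact: (mem_subseq sub).
have szb : size r' == n by rewrite sz.
apply/existsP; exists (Tuple szb); apply/and3P; split.
- by [].
- have := ncw_full r'; rewrite sz eqxx nr !andbT => /eqP ->.
  by [].
apply/forallP => i; apply/forallP => j; apply/implyP => ij.
apply: (desc_pos nr so); rewrite ?mem_tnth //.
apply: contra ij; have x0 := tnth (Tuple szb) i; rewrite !(tnth_nth x0) /=.
by rewrite nth_uniq ?sz ?sorted_pgt_uniq.
Qed.

(** The definition of [nc] picks some product of the letters in rank [#|f|]. Any arrangement giving
    such a product can be sorted by [pos_sort] without changing it, so that the choice does not
    matter. *)
Lemma nc_face (f : {set refl s}) : ncw (fword f) -> nc c f = wp (fword f).
Proof.
move=> nf; rewrite /nc.
case: pickP => [w' /= /andP[]|/(_ (wp (fword f)))]; last first.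
  rewrite inE (_ : _ \in NC s c); last by move: nf; rewrite ncwP inE => /andP[].
  have := nf; rewrite ncwP => /andP[_ /eqP ->]; rewrite size_fword eqxx /=.
  move=> /negbT/negP[]; apply/existsP; have szb :
    size (fword f) == #|f| by rewrite size_fword.
  by exists (Tuple szb); rewrite eqxx andbT {1}[f]fword_set.
rewrite !inE => /andP[le /eqP len] /existsP[r /andP[/eqP fE /eqP wE]].
have nr : ncw r by rewrite ncwP -wE le len size_tuple eqxx.
have memf t : (t \in f) = (t \in r).
  by have := congr1 (fun A : {set refl s} => t \in A) fE; rewrite inE.
have pe : perm_eq r (fword f).
  apply: uniq_perm.
  - by apply/card_uniqP; rewrite size_tuple -[RHS]cardsE; apply: eq_card => t;
    rewrite inE memf.
  - by rewrite sort_uniq enum_uniq.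
  by move=> t; rewrite mem_sort mem_enum memf.
have [|r' [pe' we so]] := pos_sort nr.
- move=> t u; rewrite !(perm_mem pe); exact: desc_pos nf (fword_sorted f) _ _.
suff -> : fword f = r' by rewrite we.
rewrite -(fwordE so); congr fword; apply/setP => t.
by rewrite inE (perm_mem pe') memf.
Qed.

(** * The dual algebra *)

Variable k : fieldType.
Local Notation PA := (dual_braid_dual s k c).
Local Notation xg := (@xgen gT n s k c).
Local Notation xw := (@xword gT n s k c).
Local Notation Rel := (@dual_braid_rels gT n s k c).
Local Notation pi_ := (alg_quot_pi (quad_rels_proper (rel_orth Rel))).
Local Notation fg := (@free_gen k (refl s)).
Local Notation tensor := (tensor2 k (refl s)).

Lemma rel_orthP (q : tensor) : rel_orth Rel q <->
  forall t u t', abs_le s (val t * val u)%g c ->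
    val t' = (val u * val t * val u)%g -> q (t, u) = q (u, t').
Proof.
have pure (x : refl s * refl s) : \sum_p q p * pure_tensor k x.1 x.2 p = q x.
  rewrite (bigD1 x) //= big1 => [|p px]; rewrite ffunE -surjective_pairing
    ?eqxx.
    by rewrite mulr1 addr0.
  by rewrite (negPf px) mulr0.
have pair t u t' : \sum_p q p * (pure_tensor k t u - pure_tensor k u t') p =
  q (t, u) - q (u, t').
  rewrite -(pure (t, u)) -(pure (u, t')) -sumrB; apply: eq_bigr => p _.
  by rewrite ffunE /= [X in _ + X]ffunE mulrBr.
split=> [h t u t' le e|h r [t [u [t' [le e ->]]]]].
  apply/eqP; rewrite -subr_eq0 -pair; apply/eqP/h.
  by exists t, u, t'.
by rewrite pair (h _ _ _ le e) subrr.
Qed.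

Lemma xrel0 (q : tensor) : rel_orth Rel q ->
  \sum_p q p *: (xg p.1 * xg p.2) = 0.
Proof.
move=> hq; have : pi_ (tensor2_free q) = pi_ 0.
  apply/alg_quot_eqP; rewrite subr0; apply/ideal_genP.
  exists 1%N, (fun=> 1), (fun=> tensor2_free q), (fun=> 1); split=> [i|].
    by exists q.
  by rewrite big_ord1 mul1r mulr1.
rewrite linear0 /tensor2_free linear_sum => e; apply: etrans e.
by apply: eq_bigr => p _; rewrite linearZ /= rmorphM.
Qed.

(** Hurwitz moves preserve products, so the indicator function of a given product lies in the
    annihilator. *)
Lemma xpair_sum0 w : \sum_(p : refl s * refl s | (val p.1 * val p.2)%g == w)
  xg p.1 * xg p.2 = 0.
Proof.
pose q : tensor := [ffun p => ((val p.1 * val p.2)%g == w)%:R].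
have e : rel_orth Rel q.
  by apply/rel_orthP => t u t' _ e; rewrite !ffunE /= e !mulgA reflK mul1g.
apply: etrans (xrel0 e); rewrite [RHS](bigID (fun p =>
  (val p.1 * val p.2)%g == w)) /=.
rewrite [X in _ + X]big1 ?addr0 => [|p /negPf pw];
  last by rewrite ffunE pw scale0r.
by apply: eq_bigr => p pw; rewrite ffunE pw scale1r.
Qed.

Lemma ncw2P t u : ncw [:: t; u] = (t != u) && abs_le s (val t * val u)%g c.
Proof.
rewrite ncwP big_cons big_seq1 refl_lengthE andbC; congr (_ && _).
have [->|tu] := eqVneq t u; first by rewrite reflK codim1.
by rewrite codim_reflection2 ?reflT.
Qed.

(** The indicator of this single pair lies in the annihilator: invariance is required only below
    [c], and a pair [(t, t)] is fixed by the Hurwitz move. *)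
Lemma xpair0 t u : ~~ ncw [:: t; u] -> xg t * xg u = 0.
Proof.
rewrite ncw2P => h; suff orth : rel_orth Rel (pure_tensor k t u).
  apply: etrans (xrel0 orth).
  rewrite (bigD1 (t, u)) //= ffunE eqxx scale1r big1 ?addr0 // => p pt.
  by rewrite ffunE (negPf pt) scale0r.
apply/rel_orthP => t1 u1 t1' le e; rewrite !ffunE; congr (_%:R);
  congr nat_of_bool.
apply/eqP/eqP => [[tt uu]|[tt uu]].
  rewrite tt uu in le e; have tu : t = u.
    by apply/eqP; apply: contraR h => ->.
  congr (_, _); apply: val_inj; first by rewrite uu tu.
  by rewrite e tu reflK mul1g.
have te : (val t1 * val u1 = val t * val u)%g by rewrite -tt -uu e !mulgA reflK
  mul1g.
rewrite te in le; have tu : t = u by apply/eqP; apply: contraR h => ->.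
have : val t1 = val u1.
  by move: te; rewrite tu reflK => te; apply: (mulIg (val u1));
    rewrite te reflK.
by move/val_inj => ->; rewrite tt tu.
Qed.

Lemma xw_cat r1 r2 : xw (r1 ++ r2) = xw r1 * xw r2.
Proof. exact: big_cat. Qed.

Lemma xw_cons t r : xw (t :: r) = xg t * xw r.
Proof. exact: big_cons. Qed.

Lemma xw_pair r1 p q r2 : xw (r1 ++ p :: q :: r2) =
  xw r1 * (xg p * xg q) * xw r2.
Proof. by rewrite xw_cat !xw_cons -[RHS]mulrA -[X in _ = _ * X]mulrA. Qed.

Lemma xw_rewrite r1 p q r2 : xw (r1 ++ p :: q :: r2) =
  - \sum_(x : refl s * refl s | ((val x.1 * val x.2)%g == (val p * val q)%g) &&
    (x != (p, q)))
      xw (r1 ++ x.1 :: x.2 :: r2).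
Proof.
have := xpair_sum0 (val p * val q)%g; rewrite (bigD1 (p, q)) //= => /eqP.
rewrite addr_eq0 => /eqP e; rewrite xw_pair e mulrN mulNr mulr_sumr mulr_suml.
by congr (- _); apply: eq_bigr => x _; rewrite xw_pair.
Qed.

(* The last letter [p] of the word with [chi p t != 0] can be pushed to the
   right until it is adjacent to [t]. *)
Lemma xw_not_ncw_rcons r1 p r2 t : ncw (r1 ++ p :: r2) ->
  chi (rt p) (rt t) != 0 ->
  (forall u, u \in r2 -> chi (rt u) (rt t) = 0) ->
    xw (rcons (r1 ++ p :: r2) t) = 0.
Proof.
elim: r2 r1 p => [|q r2 IH] r1 p nr bad good.
  rewrite -cats1 -catA /= xw_pair xpair0 ?mulr0 ?mul0r //.
  by apply: contra bad => /ncw_pair ->.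
rewrite -cats1 -catA /= -cat_cons xw_rewrite big1 ?oppr0 // =>
  -[p' q'] /= /andP[/eqP e ne].
have npq := ncw_adj nr; have pq := ncw_neq npq.
have qq' : val q' != val q.
  apply: contra ne => /eqP qE; move: e; rewrite qE => /mulIg pE.
  by apply/eqP; congr (_, _); exact: val_inj.
have pq' : val p' != val q'.
  apply: contra pq => /eqP h; move: e; rewrite h reflK => /esym h1.
  by apply/eqP; apply: (mulIg (val q)); rewrite h1 reflK.
have nr' : ncw ((r1 ++ [:: p']) ++ q' :: r2).
  by rewrite -catA /= -(ncw_eq (wp_swap r1 r2 (esym e))) // !size_cat.
have -> : r1 ++ [:: p', q' & r2 ++ [:: t]] =
  rcons ((r1 ++ [:: p']) ++ q' :: r2) t.
  by rewrite -cats1 -!catA.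
apply: IH => //; last by move=> u ur; apply: good; rewrite inE ur orbT.
(* Were [chi] zero on [q'] and [t] too, it would vanish on [p] and [t], since the root of [p] lies
   in the plane spanned by those of [q'] and [q]. *)
apply: contra bad => /eqP q't.
have qt : chi (rt q) (rt t) = 0 by apply: good; rewrite mem_head.
have : (rt p <= col_mx (rt q') (rt q))%MS.
  have sub : (col_mx (rt q') (rt q) <= move_mx (val p * val q)%g)%MS.
    rewrite -addsmxE addsmx_sub; apply/andP; split; last first.
      by rewrite (move_mx2 (reflT p) (reflT q) pq) -addsmxE addsmxSr.
    by rewrite -e (move_mx2 (reflT p') (reflT q') pq') -addsmxE addsmxSr.
  have [_ /esym] := mxrank_leqif_eq sub.
  rewrite -/(codim _) codim_reflection2 ?reflT //.
  rewrite -(eqmx_rank (introT eqmxP (move_mx2 (reflT q') (reflT q) qq')))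
    -/(codim _).
  rewrite codim_reflection2 ?reflT // eqxx => /andP[_]; apply: submx_trans.
  by rewrite (move_mx2 (reflT p) (reflT q) pq) -addsmxE addsmxSl.
by case/sub_col_mx2 => x [y ->]; rewrite chi_combl q't qt !mulr0 addr0.
Qed.

Lemma xw_not_ncw r : ~~ ncw r -> xw r = 0.
Proof.
elim/last_ind: r => [|r t IH]; first by rewrite ncw_pairwise.
have [nr|/IH e _] := boolP (ncw r); last by rewrite -cats1 xw_cat e mul0r.
rewrite [ncw (rcons _ _)]ncw_pairwise pairwise_rcons -ncw_pairwise nr andbT =>
  /allPn.
move=> hex.
have [r1 [p [r2 [re bad good]]]] : exists r1 p r2, [/\ r = r1 ++ p :: r2,
    chi (rt p) (rt t) != 0 & forall u, u \in r2 -> chi (rt u) (rt t) = 0].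
  elim: r hex {IH nr} => [[]//|u r IH] [v]; rewrite inE => vr bad.
  have [all0|] := boolP (all (fun u => chi (rt u) (rt t) == 0) r).
    exists [::], u, r; split=> //; last by move=> x /(allP all0)/eqP.
    by case/orP: vr => [/eqP <-//|/(allP all0)]; rewrite (negPf bad).
  by move/allPn/IH => [r1 [p [r2 [-> h1 h2]]]]; exists (u :: r1), p, r2.
by rewrite re in nr *; exact: xw_not_ncw_rcons.
Qed.

Lemma xw_span r : ncw r -> lin_span (fun y : PA => exists2 r',
  [/\ sorted pgt r', ncw r' & wp r' = wp r] & y = xw r') (xw r).
Proof.
have [d] := ubnP (#|refl s| ^ size r - lex_code r)%N.
elim: d r => // d IH r led nr.
have [so|/(ncw_ascent nr)[r1 [p [q [r2 [re npq lpq]]]]]] :=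
  boolP (sorted pgt r).
  by apply: lin_span_gen; exists r.
have [_ _ better] := rank2_asc npq lpq.
rewrite {2}re xw_rewrite; apply: lin_spanN;
  apply: lin_span_sum => -[p' q'] /= /andP[/eqP e ne].
have p'p : p' != p.
  apply: contra ne => /eqP pE; move: e; rewrite pE => /mulgI qE.
  by apply/eqP; congr (_, _); exact: val_inj.
have [_ lt] := better _ _ e p'p.
have we : wp (r1 ++ p' :: q' :: r2) = wp r by rewrite re; exact: wp_swap.
have se : size (r1 ++ p' :: q' :: r2) = size r by rewrite re !size_cat.
rewrite -we; apply: IH; last by rewrite (ncw_eq we se).
apply: ltn_sub_step (lex_code_bound _); first by rewrite se; exact: led.
by rewrite re; apply: lex_code_lt => //; exact: prec_rank_lt.
Qed.

(** * Linear forms attached to decreasing words *)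

Local Notation word := (seq (refl s)).

(* Sum, with signs, of the values of [F] on the words obtained from [r] by
   moving one letter to the front through Hurwitz moves and deleting it, when
   it becomes [t]. *)
Fixpoint peel (F : word -> k) (t : gT) r : k :=
  if r is x :: r' then
    (val x == t)%:R * F r' - peel (fun r2 =>
      F (x :: r2)) (val x * t * val x)%g r'
  else 0.

Lemma peel_sum (I : finType) (P : pred I) (a : I -> k) (F : I -> word ->
  k) (t : gT) r :
  peel (fun r' => \sum_(i | P i) a i * F i r') t r =
    \sum_(i | P i) a i * peel (F i) t r.
Proof.
elim: r F t => [|x r IH] F t /=; first by rewrite big1 // => i _; rewrite mulr0.
rewrite (IH (fun i r2 => F i (x :: r2))) mulr_sumr -sumrB;
  apply: eq_bigr => i _.
by rewrite mulrBr mulrCA.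
Qed.

Lemma peel0 F (t : gT) r : (forall r', F r' = 0) -> peel F t r = 0.
Proof.
move=> F0; elim: r F t F0 => //= x r IH F t F0.
by rewrite F0 mulr0 IH ?subr0.
Qed.

Lemma peel_supp F (t : gT) r : peel F t r != 0 -> exists r1 x r2,
  [/\ r = r1 ++ x :: r2, (wp r1 * val x = t * wp r1)%g & F (r1 ++ r2) != 0].
Proof.
elim: r F t => [|x r IH] F t /=; first by rewrite eqxx.
have [/eqP xt|xt] := boolP (val x == t); rewrite ?mul0r ?mul1r; last first.
  rewrite sub0r oppr_eq0 => /IH[r1 [y [r2 [-> e F0]]]].
  exists (x :: r1), y, r2; split=> //.
  by rewrite big_cons -mulgA e !mulgA reflK mul1g.
have [F0|F0 _] := eqVneq (F r) 0; last first.
  by exists [::], x, r; rewrite !big_nil mul1g mulg1.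
rewrite F0 sub0r oppr_eq0 => /IH[r1 [y [r2 [-> e F1]]]].
exists (x :: r1), y, r2; split=> //.
by rewrite big_cons -mulgA e !mulgA reflK mul1g.
Qed.

(** The linear extension of [F] to the free algebra vanishes on the ideal defining the dual algebra,
    tested on a relation placed between two words. *)
Definition kills (F : word -> k) := forall q : tensor, rel_orth Rel q ->
  forall r1 r2, \sum_p q p * F (r1 ++ p.1 :: p.2 :: r2) = 0.

(** Hurwitz moves preserve products, so [q] cut down to the pairs of product [v] remains in the
    annihilator. *)
Lemma kills_restrict F (q : tensor) v r1 r2 : kills F -> rel_orth Rel q ->
  \sum_(p | (val p.1 * val p.2)%g == v) q p * F (r1 ++ p.1 :: p.2 :: r2) = 0.
Proof.
move=> kF /rel_orthP oq.
pose q' : tensor := [ffun p => if (val p.1 * val p.2)%g == v then q p else 0].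
have oq' : rel_orth Rel q'.
  apply/rel_orthP => t u t' le e; rewrite !ffunE /= (oq _ _ _ le e) e.
  by rewrite !mulgA reflK mul1g.
have e := kF _ oq' r1 r2; apply: etrans e; rewrite [LHS]big_mkcond.
by apply: eq_bigr => p _; rewrite ffunE; case: ifP; rewrite ?mul0r.
Qed.

(** Deletions before the pair are handled by the induction on [r1]. After the pair, the letter to
    delete depends on the pair only through its product, and [kills_restrict] applies. Inside the
    pair, deleting the first letter leaves [y] with coefficient [q (t, y)], deleting the second
    leaves [y] with the opposite of [q (y, y t y)]; they cancel by Hurwitz invariance, which
    requires [t y] to be below [c]: the last hypothesis provides this wherever [F] is nonzero. *)
Lemma peel_kills F (t : gT) : t \in T -> kills F ->
  (forall r1 y r2 (u : refl s), F (r1 ++ y :: r2) != 0 ->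
     (wp r1 * val u = t * wp r1)%g -> abs_le s (val u * val y)%g c) ->
  kills (peel F t).
Proof.
move=> tT kF sF q oq r1 r2; elim: r1 F t tT kF sF => [|a r1 IH] F t tT kF sF;
  last first.
  have e1 := kF _ oq r1 r2.
  have e2 := IH (fun r => F (a :: r)) (val a * t * val a)%g.
  rewrite (eq_bigr (fun p => (val a == t)%:R * (q p * F (r1 ++ p.1 :: p.2 ::
    r2)) -
      q p * peel (fun r => F (a :: r)) (val a * t * val a)%g (r1 ++ p.1 :: p.2
        :: r2))).
    rewrite sumrB -mulr_sumr e1 mulr0 e2 ?subr0 //.
    - by rewrite -{2}(reflV a) reflection_conj.
    - by move=> q' oq' s1 s2; exact: kF _ oq' (a :: s1) s2.
    move=> s1 y s2 u /= F0 e; apply: (sF (a :: s1) y s2 u) => //.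
    by rewrite big_cons -mulgA e !mulgA reflK mul1g.
  by move=> p _ /=; rewrite mulrBr mulrCA.
pose t0 := mkrefl tT.
have conjE (x : refl s) : (val x * t * val x)%g \in T.
  by rewrite -{2}(reflV x) reflection_conj.
pose G (p : refl s * refl s) : gT := (val p.1 * val p.2)%g.
pose Tm p := peel (fun r => F (p.1 :: p.2 :: r)) (val p.2 * (val p.1 * t * val
  p.1) * val p.2)%g r2.
(* Deletion of the first letter of the pair, of the second, and of a later letter. *)
transitivity (\sum_(p : refl s * refl s) q p * ((val p.1 == t)%:R * F (p.2 ::
  r2))
  - \sum_(p : refl s * refl s) q p * ((val p.2 == (val p.1 * t * val p.1)%g)%:R
    * F (p.1 :: r2))
  + \sum_p q p * Tm p).
  rewrite -sumrB -big_split; apply: eq_bigr => p _ /=.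
  by rewrite -/(Tm p); ring.
have -> : \sum_p q p * Tm p = 0.
  rewrite (partition_big G predT) //= big1 // => v _.
  have e : peel (fun r => \sum_(p | G p == v) q p * F (p.1 :: p.2 :: r)) (v^-1 *
    t * v)%g r2 = 0.
    by apply: peel0 => r; exact: (@kills_restrict F q v [::] r kF oq).
  apply: etrans e; rewrite (peel_sum _ _ (fun p r => F (p.1 :: p.2 :: r))).
  apply: eq_bigr => p /eqP <-.
  by congr (_ * _); rewrite /Tm; congr peel; rewrite /G invMg !reflV !mulgA.
rewrite addr0.
have -> : \sum_(p : refl s * refl s) q p * ((val p.1 == t)%:R * F (p.2 :: r2)) =
    \sum_y q (t0, y) * F (y :: r2).
  transitivity (\sum_x \sum_y q (x, y) * ((val x == t)%:R * F (y :: r2))).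
    by rewrite pair_bigA; apply: eq_bigr => -[x y].
  rewrite (bigD1 t0) //= [X in _ + X]big1 ?addr0 => [|x xt].
    by apply: eq_bigr => y _; rewrite eqxx mul1r.
  rewrite big1 // => y _; have /negPf -> : val x != t.
    by apply: contra xt => /eqP h; apply/eqP/val_inj.
  by rewrite mul0r mulr0.
have -> : \sum_(p : refl s * refl s) q p *
    ((val p.2 == (val p.1 * t * val p.1)%g)%:R * F (p.1 :: r2)) =
    \sum_x q (x, mkrefl (conjE x)) * F (x :: r2).
  transitivity (\sum_x \sum_y q (x, y) * ((val y == (val x * t * val x)%g)%:R *
    F (x :: r2))).
    by rewrite pair_bigA; apply: eq_bigr => -[x y].
  apply: eq_bigr => x _; rewrite (bigD1 (mkrefl (conjE x))) //= eqxx mul1r.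
  rewrite big1 ?addr0 // => y yt; have /negPf ->
    : val y != (val x * t * val x)%g.
    by apply: contra yt => /eqP h; apply/eqP/val_inj.
  by rewrite mul0r mulr0.
rewrite -sumrB big1 // => y _; have [->|F0] := eqVneq (F (y :: r2)) 0.
  by rewrite !mulr0 subrr.
have le : abs_le s (val t0 * val y)%g c.
  by apply: (sF [::] y r2 t0) => //; rewrite big_nil mul1g mulg1.
by move/rel_orthP: oq => /(_ t0 y (mkrefl (conjE y)) le erefl) ->;
  rewrite subrr.
Qed.

(* The fundamental cycle of the Boolean sublattice of NC formed by the products
   of the subwords of [f], as a function on maximal chains. *)
Fixpoint cycle_val (f : word) (r : word) : k :=
  if f is t :: f' then peel (cycle_val f') (val t) r else (r == [::])%:R.

Lemma cycle_val_supp f r : cycle_val f r != 0 -> wp r = wp f /\ size r = size f.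
Proof.
elim: f r => [|t f IH] r /=.
  by case: (r =P [::]) => [->|]; rewrite ?eqxx.
case/peel_supp => r1 [x [r2 [-> e /IH[we se]]]]; split; last first.
  by rewrite -se !size_cat /= addnS.
rewrite [RHS]big_cons -we !big_cat big_cons /= mulgA e.
by rewrite -!mulgA.
Qed.

(** The side condition of [peel_kills] holds because inserting [u] produces a word with the product
    and the length of [t :: f], whose adjacent letters are therefore below [c]. *)
Lemma cycle_val_kills f : ncw f -> kills (cycle_val f).
Proof.
elim: f => [|t f IH] nf /=.
  move=> q _ r1 r2; rewrite big1 // => p _.
  by case: r1 => [|? ?]; rewrite mulr0.
have nf' : ncw f by apply: ncw_subseq nf; exact: subseq_cons.
apply: peel_kills; [exact: reflT | exact: IH|].
move=> r1 y r2 u /cycle_val_supp[we se] e.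
have : ncw (r1 ++ u :: y :: r2).
  rewrite (@ncw_eq _ (t :: f)) //; last by rewrite /= -se !size_cat /= !addnS.
  by rewrite [RHS]big_cons -we !big_cat !big_cons /= !mulgA e.
by move/ncw_adj; rewrite ncw2P => /andP[].
Qed.

(** In the second term of [peel], the letter [x] also begins a word in the support of [cycle_val f].
    So it is at most the first letter of [f], which lies below [t] as [t :: f] is decreasing. *)
Lemma cycle_val_head x r t f : sorted pgt (t :: f) ->
  peel (fun r2 => cycle_val f (x :: r2)) (val x * val t * val x)%g r != 0 ->
  (forall r', cycle_val f r' != 0 -> r' = f \/ (lex_code r' < lex_code f)%N) ->
    (prec_rank x < prec_rank t)%N.
Proof.
move=> so /peel_supp[r1 [y [r2 [_ _ p0]]]] /(_ _ p0) h.
have [_ se] := cycle_val_supp p0; case: f so p0 h se =>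
  [//|u f] /= /andP[tu _] _ h [se].
have xu : (prec_rank x <= prec_rank u)%N.
  case: h => [[-> _]//|lt]; rewrite leqNgt;
    apply/negP => /(lex_code_lt [::] (esym se)) /= lt'.
  by have := ltn_trans lt lt'; rewrite ltnn.
exact: leq_ltn_trans xu (prec_rank_lt tu).
Qed.

Lemma cycle_val_code f : sorted pgt f -> forall r, cycle_val f r != 0 ->
  r = f \/ (lex_code r < lex_code f)%N.
Proof.
elim: f => [|t f IH] so r; first by rewrite /=; case: (r =P [::]) => [->|];
  rewrite ?eqxx; left.
have sof : sorted pgt f := path_sorted so.
case: r => [|x r']; first by rewrite /= eqxx.
move=> p0; have [_ /= [se]] := cycle_val_supp p0.
have [h0|h0] := eqVneq (peel (fun r2 => cycle_val f (x :: r2)) (val x * val t *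
  val x)%g r') 0.
  move: p0; rewrite /= h0 subr0; have [/eqP/val_inj ->|_] :=
    boolP (val x == val t).
    rewrite mul1r => /(IH sof)[->|lt]; first by left.
    by right; rewrite se ltn_add2l.
  by rewrite mul0r eqxx.
right; apply: (lex_code_lt [::] se); exact: cycle_val_head so h0 (IH sof).
Qed.

Lemma cycle_val_id f : sorted pgt f -> cycle_val f f = 1.
Proof.
elim: f => [//|t f IH] so; have sof : sorted pgt f := path_sorted so.
rewrite /= eqxx mul1r IH //.
have [->|h0] := eqVneq (peel (fun r2 => cycle_val f (t :: r2)) (val t * val t *
  val t)%g f) 0.
  by rewrite subr0.
by have := cycle_val_head so h0 (cycle_val_code sof); rewrite ltnn.
Qed.

(** * Extension to the free algebra and linear independence *)

Local Notation FA := (free_alg k (refl s)).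

Definition mon (a : k) (r : word) : FA := << a *g FMonom r >>.

Lemma monM (a b : k) r r' : mon a r * mon b r' = mon (a * b) (r ++ r').
Proof. by rewrite /mon malgM_def fgmulUU -(fmmulE (FMonom r) (FMonom r')). Qed.

Lemma monZ (a b : k) r : a *: mon b r = mon (a * b) r.
Proof. by apply/malgP => m; rewrite [LHS]mcoeffZ [X in _ * X]mcoeffU
  [RHS]mcoeffU mulrnAr. Qed.

Lemma free_gen_mon t : fg t = mon 1 [:: t].
Proof. by rewrite /mon -fmuE. Qed.

Lemma mon_sum (u : FA) : u = \sum_(m <- msupp u) mon u@_m (m :
  {fmonom (refl s)}).
Proof. by rewrite [LHS]monalgE; apply: eq_bigr => m _; rewrite /mon fmK. Qed.

Definition cycle_form f (u : FA) : k := mmap idfun (fun m :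
  {fmonom (refl s)} => cycle_val f m) u.

Lemma cycle_formD f (u v : FA) : cycle_form f (u + v) =
  cycle_form f u + cycle_form f v.
Proof. exact: mmapD. Qed.

Lemma cycle_form_sum f (I : Type) (r : seq I) (P : pred I) (E : I -> FA) :
  cycle_form f (\sum_(i <- r | P i) E i) =
  \sum_(i <- r | P i) cycle_form f (E i).
Proof. by apply: (big_morph (cycle_form f));
  [exact: cycle_formD | exact: mmap0]. Qed.

Lemma cycle_form_mon f (a : k) r : cycle_form f (mon a r) = a * cycle_val f r.
Proof. exact: mmapU. Qed.

Lemma cycle_form_ideal f (u : FA) : ncw f ->
  ideal_gen (quad_rels (rel_orth Rel)) u -> cycle_form f u = 0.
Proof.
move=> nf [N [a [g [b [hg ->]]]]]; rewrite cycle_form_sum big1 // => i _.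
have [q oq ->] := hg i; rewrite /tensor2_free.
rewrite [a i]mon_sum [b i]mon_sum (mulr_sum3 _ _ (fun m => mon (a i)@_m m)).
rewrite cycle_form_sum big1 // => m _; rewrite cycle_form_sum big1 // => m' _;
  rewrite cycle_form_sum.
have e := cycle_val_kills nf oq m m'.
transitivity ((a i)@_m * (b i)@_m' * \sum_p q p * cycle_val f (m ++ p.1 :: p.2
  :: m')).
  rewrite mulr_sumr; apply: eq_bigr => p _.
  rewrite !free_gen_mon !monM monZ !monM cycle_form_mon -!catA /=; ring.
by rewrite e mulr0.
Qed.

Lemma xw_mon r : xw r = pi_ (mon 1 r).
Proof.
elim: r => [|t r IH].
  rewrite /xword big_nil -(rmorph1 pi_); congr pi_.
  by rewrite /mon -fmoneE.
by rewrite xw_cons IH /xgen /quad_dual_gen /quad_gen -rmorphM free_gen_mon monM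
  mulr1.
Qed.

(** Triangularity: the form of the word of [f0] kills the dependence lifted to the free algebra. It
    takes the value 1 on the word of [f0], and is otherwise nonzero only on words of smaller code,
    whose coefficients vanish by induction. *)
Lemma face_free (A : {set {set refl s}}) (a : {set refl s} -> k) :
  (forall f, f \in A -> ncw (fword f)) ->
  \sum_(f in A) a f *: xw (fword f) = 0 -> forall f, f \in A -> a f = 0.
Proof.
move=> hA e f0 f0A; have [d] := ubnP (lex_code (fword f0)).
elim: d f0 f0A => // d IH f0 f0A led.
have : pi_ (\sum_(f in A) mon (a f) (fword f)) = pi_ 0.
  rewrite linear0 linear_sum -[RHS]e; apply: eq_bigr => f _.
  by rewrite xw_mon -linearZ monZ mulr1.
move/alg_quot_eqP; rewrite subr0 => /ideal_genP /(cycle_form_ideal (hA _ f0A)).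
rewrite cycle_form_sum (bigD1 f0) //= cycle_form_mon cycle_val_id ?fword_sorted
  // mulr1 big1 ?addr0 // => f /andP[fA ff].
rewrite cycle_form_mon; have [->|/(cycle_val_code (fword_sorted f0))[h|lt]] :=
  eqVneq (cycle_val (fword f0) (fword f)) 0.
- by rewrite mulr0.
- by move: ff; rewrite [f]fword_set h -fword_set eqxx.
- by rewrite IH ?mul0r //; exact: leq_trans lt led.
Qed.

Theorem positive_cluster_basis :
  (forall w : gT, w \in NC s c ->
     is_basis [set f in pos_cluster_complex s R c | nc c f == w]
       (xface k c prec) (P_part s k c w)) /\
  is_basis (pos_cluster_complex s R c) (xface k c prec) classical_sets.setT.
Proof.
split=> [w wNC|].
  split.
    by move=> a; apply: face_free => f; rewrite inE face_desc => /andP[].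
  apply/seteqP; split=> v.
    apply: lin_span_sub => u [f]; rewrite inE face_desc => /andP[nf /eqP fw] ->.
    apply: lin_span_gen.
    have sz : size (fword f) == refl_length s w.
      by rewrite -fw nc_face //; move: nf; rewrite ncwP eq_sym => /andP[].
    by exists (Tuple sz) => //=; rewrite -fw nc_face.
  apply: lin_span_sub => u [r rw ->].
  have nr : ncw r by rewrite ncwP rw size_tuple eqxx andbT; move: wNC;
    rewrite inE.
  apply: lin_span_sub (xw_span nr) => u' [r' [so nr' we] ->].
  apply: lin_span_gen; exists [set t in r'];
    last by rewrite /xface -/(fword _) fwordE.
  by rewrite inE face_desc nc_face fwordE // nr' we rw eqxx.
split; first by move=> a; apply: face_free => f; rewrite face_desc.
apply/seteqP; split=> // v _.
have -> : v = pi_ (generic_quotient.repr v) by rewrite /alg_quot_pi reprK.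
rewrite (mon_sum (generic_quotient.repr v)) linear_sum;
  apply: lin_span_sum => m _.
have e x : pi_ (mon x m) = x *: xw m by rewrite xw_mon -linearZ monZ mulr1.
rewrite /= e.
apply: lin_spanZ; have [nm|/xw_not_ncw->] := boolP (ncw m);
  last exact: lin_span0.
apply: lin_span_sub (xw_span nm) => u' [r' [so nr' _] ->].
apply: lin_span_gen; exists [set t in r'];
  last by rewrite /xface -/(fword _) fwordE.
by rewrite face_desc fwordE.
Qed.

End CoxeterGeometry.

Theorem theorem5p12 (R : realType) (k : fieldType) (gT : finGroupType)
    (n : nat) (s : 'I_n -> gT) (c : gT) (prec : rel (refl s))
    (hW : coxeter_system s) (hc : coxeter_element s c)
    (hprec : reflection_ordering R prec) (hcomp : c_compatible c prec) :
  (forall w : gT, w \in NC s c ->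
     is_basis [set f in pos_cluster_complex s R c | nc c f == w]
       (xface k c prec) (P_part s k c w)) /\
  is_basis (pos_cluster_complex s R c) (xface k c prec) classical_sets.setT.
Proof.
have [Phi [Phi1 PhiM PhiS]] := geometric_representation R hW.
exact: (positive_cluster_basis hW Phi1 PhiM PhiS hc hprec hcomp).
Qed.
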